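(* Let $F\in\mathbb{D}^{\infty,2,\sigma}$ have chaotic expansion $F=\sum_{n=0}^{\infty}I_n(f_n)$, with $f_n\in L^2(\mathbb{R}_+^n)$. Then for all $n\ge 0$ and Lebesgue-almost all $t_1,\dots,t_n\ge 0$, $$f_n(t_1,\dots,t_n)=\tau^{\otimes(n+1)}\big(\nabla^n_{t_1,\dots,t_n}F\big),$$ or equivalently, in symmetrized form, $$f_n(t_1,\dots,t_n)=\frac{1}{n!}\,\tau^{\otimes(n+1)}\big(D^n_{t_1,\dots,t_n}F\big).$$
   Context: Setting. Inner products are linear in the first variable. On the full Fock space $\mathbb{C}\Omega\oplus\bigoplus_{n\ge1}L^2(\mathbb{R}_+)^{\otimes n}$ (complex $L^2$, $\|\Omega\|=1$), let $l(h)$ be the left creation operator, $l(h)\Omega=h$, $l(h)(g_1\otimes\cdots\otimes g_n)=h\otimes g_1\otimes\cdots\otimes g_n$, and for real-valued $h\in L^2_{\mathbb{R}}(\mathbb{R}_+)$ let $S(h)=l(h)+l(h)^*$. $\mathcal{SC}$ is the von Neumann algebra generated by $\{S(h):h\in L^2_{\mathbb{R}}(\mathbb{R}_+)\}$ and $\tau(X)=\langle X\Omega,\Omega\rangle$ its faithful normal tracial state; $L^2(\mathcal{SC})$ has inner product $\langle X,Y\rangle=\tau(Y^*X)$. $\mathcal{SC}_{alg}$ is the unital $*$-algebra generated by the $S(h)$, $h\in L^2_{\mathbb{R}}(\mathbb{R}_+)$. Wigner integrals. The map $X\mapsto X\Omega$ extends to a unitary from $L^2(\mathcal{SC})$ onto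 the Fock space. For $f\in L^2(\mathbb{R}_+^n)\cong L^2(\mathbb{R}_+)^{\otimes n}$, $I_n(f)$ is the element of $L^2(\mathcal{SC})$ corresponding to $f$ (and $I_0(c)=c1$). Every $F\in L^2(\mathcal{SC})$ has a unique expansion $F=\sum_{n\ge0}I_n(f_n)$. Malliavin derivative. $\nabla$ is the linear map on $\mathcal{SC}_{alg}$, $A\mapsto(\nabla_tA)_{t\ge0}$, with $\nabla_tS(h)=h(t)\,1\otimes1$ and $\nabla_t(AB)=A\cdot\nabla_tB+\nabla_tA\cdot B$, where $A\cdot(x\otimes y)\cdot B=Ax\otimes yB$. Iterated derivatives on $\mathcal{SC}_{alg}$: $\nabla^0=\mathrm{id}$ and, for $n\ge1$, $\nabla^n_{t_1,\dots,t_n}=(\mathrm{id}^{\otimes(n-1)}\otimes\nabla_{t_n})\circ\cdots\circ(\mathrm{id}\otimes\nabla_{t_2})\circ\nabla_{t_1}$; set $D^n=n!\,\nabla^n$. Let $\mathbb{M}_2^{k,k+1}=L^2(\mathbb{R}_+^k;L^2(\mathcal{SC}^{\otimes(k+1)},\tau^{\otimes(k+1)}))$. For $k\ge1$, $\nabla^k$ and $D^k$ are closable from $L^2(\mathcal{SC})$ to $\mathbb{M}_2^{k,k+1}$ (closures denoted by the same symbols). $\mathbb{D}^{k,2,\sigma}$ is the completion of $\mathcal{SC}_{alg}$ for $\|F\|_{k,2,\sigma}^2=\|F\|_2^2+\sum_{j=1}^k\|D^jF\|^2_{\mathbb{M}_2^{j,j+1}}$, and $\mathbb{D}^{\infty,2,\sigma}=\bigcap_{k\ge1}\mathbb{D}^{k,2,\sigma}$.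 *)

(* Defs.v *)
From HB Require Import structures.
From mathcomp Require Import all_boot all_order all_algebra complex.
From mathcomp Require Import all_classical all_reals all_analysis.

Set Implicit Arguments.
Unset Strict Implicit.
Unset Printing Implicit Defensive.
Import Order.TTheory GRing.Theory Num.Theory.
Import numFieldNormedType.Exports.
Local Open Scope classical_set_scope.
Local Open Scope ring_scope.
Local Open Scope complex_scope.

Lemma sigma_finite_prod d1 d2 (T1 : measurableType d1)
    (T2 : measurableType d2) (R : realType)
    (m1 : {sigma_finite_measure set T1 -> \bar R})
    (m2 : {sigma_finite_measure set T2 -> \bar R}) :
  sigma_finite setT (m1 \x m2)%E.
Proof.
have /sigma_finiteP[F [TF ndF Foo]] := sigma_finiteT m1.
have /sigma_finiteP[G [TG ndG Goo]] := sigma_finiteT m2.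
exists (fun n => F n `*` G n).
  rewrite -setXTT TF TG predeqE => -[x y]; split.
    move=> [/= [n _ Fnx] [k _ Gky]]; exists (maxn n k) => //; split.
    - by move: x Fnx; exact/subsetPset/ndF/leq_maxl.
    - by move: y Gky; exact/subsetPset/ndG/leq_maxr.
  by move=> [n _ []/= ? ?]; split; exists n.
move=> k; have [? ?] := Foo k; have [? ?] := Goo k.
split; first exact: measurableX.
by rewrite product_measure1E// lte_mul_pinfty// ge0_fin_numE.
Qed.

Section lebesgue_tuple.
Variable R : realType.
Local Notation mR := (measurableTypeR R).

Definition tcons n (p : mR * n.-tuple mR) : n.+1.-tuple mR :=
  [the n.+1.-tuple mR of p.1 :: p.2].

Lemma measurable_tcons n : measurable_fun [set: mR * n.-tuple mR] (@tcons n).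
Proof. exact: measurable_cons. Qed.

Definition lebS n (m : {sigma_finite_measure set (n.-tuple mR) -> \bar R}) :
  set (n.+1.-tuple mR) -> \bar R :=
  pushforward (@lebesgue_measure R \x m)%E (@tcons n).

Section lebS_measure.
Variables (n : nat) (m : {sigma_finite_measure set (n.-tuple mR) -> \bar R}).

Let lebS0 : lebS m set0 = 0%E.
Proof. by rewrite /lebS /pushforward preimage_set0 measure0. Qed.

Let lebS_ge0 A : (0 <= lebS m A)%E.
Proof. by rewrite /lebS /pushforward measure_ge0. Qed.

Let lebS_sigma_additive : semi_sigma_additive (lebS m).
Proof.
move=> F mF tF mUF; rewrite /lebS /pushforward preimage_bigcup.
have mT A : measurable A -> measurable (@tcons n @^-1` A).
  by move=> mA; rewrite -[X in measurable X]setTI; exact: measurable_tcons.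
apply: measure_semi_sigma_additive.
- by move=> i; exact: mT.
- apply/trivIsetP => /= i j _ _ ij; rewrite -preimage_setI.
  by move/trivIsetP : tF => /(_ _ _ _ _ ij) ->//; rewrite preimage_set0.
- by rewrite -preimage_bigcup; exact: mT.
Qed.

HB.instance Definition _ := isMeasure.Build _ _ _ (lebS m)
  lebS0 lebS_ge0 lebS_sigma_additive.

Let lebS_sigma_finite : sigma_finite setT (lebS m).
Proof.
have [F FT Fm] : sigma_finite setT (@lebesgue_measure R \x m)%E.
  exact: sigma_finite_prod.
pose g (s : n.+1.-tuple mR) : mR * n.-tuple mR := (thead s, [tuple of behead s]).
have mg : measurable_fun [set: n.+1.-tuple mR] g.
  apply: measurable_fun_pair; first exact: measurable_tnth.
  exact: measurable_behead.
have gK p : g (tcons p) = p.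
  by case: p => x t; rewrite /g /tcons /= theadE; congr pair; exact: val_inj.
exists (fun i => g @^-1` F i).
  by rewrite -preimage_bigcup -FT preimage_setT.
move=> i; have [mF Foo] := Fm i; split.
  by rewrite -[X in measurable X]setTI; exact: mg.
rewrite /lebS /pushforward -comp_preimage.
by rewrite (_ : g \o @tcons n = id) ?preimage_id//; apply/funext => p /=.
Qed.

HB.instance Definition _ :=
  Measure_isSigmaFinite.Build _ _ _ (lebS m) lebS_sigma_finite.

End lebS_measure.

(* Lebesgue measure on R^n; R^0 is a point of mass 1. *)
Fixpoint leb n : {sigma_finite_measure set (n.-tuple mR) -> \bar R} :=
  match n with
  | 0%N => [the {sigma_finite_measure set (0.-tuple mR) -> \bar R} of
              dirac ([tuple] : 0.-tuple mR)]
  | k.+1 => [the {sigma_finite_measure set (k.+1.-tuple mR) -> \bar R} of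
              lebS (leb k)]
  end.

Definition Rplus : set mR := [set x : R | 0 <= x].

Definition Rplusn n : set (n.-tuple mR) := [set t | forall i, 0 <= tnth t i].

End lebesgue_tuple.

Section square_integrable.
Variable R : realType.
Local Notation mR := (measurableTypeR R).

Definition sqnormc (z : R[i]) : R := complex.Re z ^+ 2 + complex.Im z ^+ 2.

Section generic.
Context d (T : measurableType d) (mu : {measure set T -> \bar R}) (D : set T).

(* Elements of L^2(D, mu; C) are represented by functions, equal almost
   everywhere on D when they represent the same element. *)
Definition sqint (f : T -> R[i]) : Prop :=
  [/\ measurable_fun D (fun t => complex.Re (f t)),
      measurable_fun D (fun t => complex.Im (f t)) &
      (\int[mu]_(t in D) (sqnormc (f t))%:E < +oo)%E].

Definition cintegral (f : T -> R[i]) : R[i] :=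
  Rintegral mu D (fun t => complex.Re (f t)) +i*
  Rintegral mu D (fun t => complex.Im (f t)).

Definition L2dot (f g : T -> R[i]) : R[i] :=
  cintegral (fun t => f t * Num.conj (g t)).

End generic.

Definition L2n n (f : n.-tuple mR -> R[i]) : Prop :=
  sqint (@leb R n) (@Rplusn R n) f.

Definition L2ndot n (f g : n.-tuple mR -> R[i]) : R[i] :=
  L2dot (@leb R n) (@Rplusn R n) f g.

Record L2R := MkL2R {
  L2R_fun :> mR -> R;
  L2R_prop : sqint (@lebesgue_measure R) (@Rplus R) (fun t => (L2R_fun t)%:C) }.

Definition tens n (h : mR -> R[i]) (g : n.-tuple mR -> R[i]) :
    n.+1.-tuple mR -> R[i] :=
  fun t => h (thead t) * g [tuple of behead t].

End square_integrable.

Section hilbert.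
Variable R : realType.

Section norm.
Variables (V : lmodType R[i]) (dot : {dot V for Num.conj}).

Definition dotnorm2 (x : V) : R := complex.Re (dot x x).
Definition dotnorm (x : V) : R := Num.sqrt (dotnorm2 x).

Definition dotcomplete : Prop := forall u : nat -> V,
  (forall e : R, 0 < e -> exists N, forall p q, (N <= p)%N -> (N <= q)%N ->
     dotnorm (u p - u q) < e) ->
  exists l, dotnorm (u n - l) @[n --> \oo] --> (0 : R).

End norm.

Record hilbert := Hilbert {
  hcar :> lmodType R[i];
  hdot : {dot hcar for Num.conj};
  hcomplete : dotcomplete hdot }.

Definition hnorm2 (H : hilbert) (x : H) : R := dotnorm2 (hdot H) x.
Definition hnorm (H : hilbert) (x : H) : R := dotnorm (hdot H) x.

Definition hcvg (H : hilbert) (u : nat -> H) (l : H) : Prop :=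
  hnorm (u n - l) @[n --> \oo] --> (0 : R).

Definition bounded_op (H : hilbert) (T : H -> H) : Prop :=
  linear T /\ exists M : R, forall x, hnorm (T x) <= M * hnorm x.

Definition adjoint (H : hilbert) (T Ts : H -> H) : Prop :=
  forall x y, hdot H (T x) y = hdot H x (Ts y).

(* Bochner measurability of a function with values in H: pointwise limit, on D,
   of a sequence of simple functions. *)
Definition simple_Hfun d (T : measurableType d) (H : hilbert) (s : T -> H) :
    Prop :=
  exists N (A : 'I_N -> set T) (v : 'I_N -> H), (forall i, measurable (A i)) /\
    forall t, s t = \sum_(i < N) (\1_(A i) t : R)%:C *: v i.

Definition strongly_measurable d (T : measurableType d) (D : set T)
    (H : hilbert) (G : T -> H) : Prop :=
  exists s : nat -> T -> H, (forall m, simple_Hfun (s m)) /\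
    forall t, D t -> hcvg (s ^~ t) (G t).

End hilbert.

(* A Fock space is a Hilbert space which is the Hilbert sum of the isometric
   images of L^2(R_+^n), n >= 0, where L^2(R_+^n) is identified with the n-th
   Hilbert tensor power of L^2(R_+) and R_+^0 is a point of mass 1; the
   operators l(h) are determined by their values on these summands. *)
Record fock (R : realType) := Fock {
  fcar :> hilbert R;
  chaos : forall n, (n.-tuple (measurableTypeR R) -> R[i]) -> fcar;
  chaos_linear : forall n (a : R[i]) f g, L2n f -> L2n g ->
    @chaos n (fun t => a * f t + g t) = a *: chaos f + chaos g;
  chaos_isometry : forall n (f g : n.-tuple (measurableTypeR R) -> R[i]),
    L2n f -> L2n g -> hdot fcar (chaos f) (chaos g) = L2ndot f g;
  chaos_orthogonal : forall m n (f : m.-tuple (measurableTypeR R) -> R[i])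
      (g : n.-tuple (measurableTypeR R) -> R[i]),
    L2n f -> L2n g -> m <> n -> hdot fcar (chaos f) (chaos g) = 0;
  chaos_sum : forall psi : fcar,
    exists f : forall n, n.-tuple (measurableTypeR R) -> R[i],
      (forall n, L2n (f n)) /\
      hcvg (fun N => \sum_(k < N) chaos (f k)) psi;
  creation : (measurableTypeR R -> R[i]) -> fcar -> fcar;
  annihilation : (measurableTypeR R -> R[i]) -> fcar -> fcar;
  creation_bounded : forall h, sqint (@lebesgue_measure R) (@Rplus R) h ->
    bounded_op (creation h);
  creationE : forall h n (g : n.-tuple (measurableTypeR R) -> R[i]),
    sqint (@lebesgue_measure R) (@Rplus R) h -> L2n g ->
    creation h (chaos g) = chaos (tens h g);
  annihilation_bounded : forall h, sqint (@lebesgue_measure R) (@Rplus R) h ->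
    bounded_op (annihilation h);
  annihilationE : forall h, sqint (@lebesgue_measure R) (@Rplus R) h ->
    adjoint (creation h) (annihilation h) }.

Arguments chaos {R} f {n} _ : rename.

Section semicircular.
Variables (R : realType) (Fk : fock R).

Definition vacuum : Fk := chaos Fk (fun _ : 0.-tuple (measurableTypeR R) => 1).

Definition Sop (h : L2R R) (psi : Fk) : Fk :=
  creation (fun t => (h t)%:C) psi + annihilation (fun t => (h t)%:C) psi.

(* The von Neumann algebra generated by the self-adjoint family S(h) is its
   bicommutant. *)
Definition SC : set (Fk -> Fk) := [set X | bounded_op X /\
  forall Y : Fk -> Fk, bounded_op Y -> (forall h, Y \o Sop h = Sop h \o Y) ->
    X \o Y = Y \o X].

Definition tau (X : Fk -> Fk) : R[i] := hdot Fk (X vacuum) vacuum.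

(* L^2 of the (k+1)-st tensor power of (SC, tau): the Hilbert space completion
   of the algebraic tensor power of SC, Lam X being the class of
   X_0 (x) ... (x) X_k. *)
Record L2SC (k : nat) := MkL2SC {
  lcar :> hilbert R;
  Lam : ('I_k.+1 -> Fk -> Fk) -> lcar;
  Lam_linear : forall (X : 'I_k.+1 -> Fk -> Fk) i (a : R[i]) (A B : Fk -> Fk),
    (forall j, SC (X j)) -> SC A -> SC B ->
    Lam (fun j => if j == i then fun psi => a *: A psi + B psi else X j) =
    a *: Lam (fun j => if j == i then A else X j) +
    Lam (fun j => if j == i then B else X j);
  Lam_dot : forall X Y Ys : 'I_k.+1 -> Fk -> Fk,
    (forall j, SC (X j)) -> (forall j, SC (Y j)) ->
    (forall j, bounded_op (Ys j) /\ adjoint (Y j) (Ys j)) ->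
    hdot lcar (Lam X) (Lam Y) = \prod_(j < k.+1) tau (Ys j \o X j);
  Lam_dense : forall (x : lcar) (e : R), 0 < e ->
    exists N (X : 'I_N -> 'I_k.+1 -> Fk -> Fk), (forall i j, SC (X i j)) /\
      hnorm (x - \sum_(i < N) Lam (X i)) < e }.

Arguments Lam {k} l _ : rename.

(* The trace of X is <X, 1>; this is its continuous extension to L^2. *)
Definition tautens k (L : L2SC k) (x : L) : R[i] :=
  hdot L x (Lam L (fun _ => id)).

(* The unitary of L^2(SC) onto the Fock space extending X |-> X vacuum. *)
Definition vacuum_unitary (L : L2SC 0) (U : L -> Fk) : Prop :=
  [/\ linear U, forall x, hnorm (U x) = hnorm x,
      forall psi, exists x, U x = psi &
      forall X, SC X -> U (Lam L (fun _ => X)) = X vacuum].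

Definition wigner (L : L2SC 0) (U : L -> Fk) n
    (f : n.-tuple (measurableTypeR R) -> R[i]) : L :=
  xget 0 [set J | U J = chaos Fk f].

Definition chaos_expansion (L : L2SC 0) (U : L -> Fk) (F : L)
    (f : forall n, n.-tuple (measurableTypeR R) -> R[i]) : Prop :=
  hcvg (fun N => \sum_(k < N) wigner U (f k)) F.

End semicircular.

Arguments Lam {R Fk k} l _ : rename.

(* Expressions for the elements of SC_alg: constants, S(h), sums, products.
   As each S(h) is self-adjoint, their values form the unital *-algebra
   generated by the S(h). *)
Inductive scalg (R : realType) :=
  | SCconst of R[i]
  | SCgen of L2R R
  | SCadd of scalg R & scalg R
  | SCmul of scalg R & scalg R.

Arguments SCconst {R} _.

Section malliavin.
Variables (R : realType) (Fk : fock R) (L2 : forall k, L2SC Fk k).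
Local Notation mR := (measurableTypeR R).

Fixpoint sceval (P : scalg R) : Fk -> Fk :=
  match P with
  | SCconst c => fun psi => c *: psi
  | SCgen h => Sop h
  | SCadd A B => fun psi => sceval A psi + sceval B psi
  | SCmul A B => sceval A \o sceval B
  end.

Definition SCsub (A B : scalg R) : scalg R :=
  SCadd A (SCmul (SCconst (-1)) B).

(* nabla_t, valued in formal sums (sequences) of elementary tensors x (x) y.
   It is defined on expressions: two expressions with the same value in SC_alg
   have derivatives with the same value for almost every t. *)
Fixpoint grad (t : R) (P : scalg R) : seq (scalg R * scalg R) :=
  match P with
  | SCconst _ => [::]
  | SCgen h => [:: (SCconst (h t)%:C, SCconst 1)]
  | SCadd A B => grad t A ++ grad t B
  | SCmul A B => [seq (SCmul A xy.1, xy.2) | xy <- grad t B] ++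
                 [seq (xy.1, SCmul xy.2 B) | xy <- grad t A]
  end.

(* The pair (p, x) stands for the elementary tensor with factors
   p_0, p_1, ..., x; only the last factor is differentiated. *)
Definition grad_last (t : R) (px : seq (scalg R) * scalg R) :
    seq (seq (scalg R) * scalg R) :=
  [seq (rcons px.1 uv.1, uv.2) | uv <- grad t px.2].

(* (id^{(x)(n-1)} (x) nabla_{t_n}) o ... o nabla_{t_1} for ts = t_1, ..., t_n *)
Definition itgrad (ts : seq R) (P : scalg R) : seq (seq (scalg R) * scalg R) :=
  foldl (fun T t => flatten [seq grad_last t px | px <- T]) [:: ([::], P)] ts.

Definition tensval k (px : seq (scalg R) * scalg R) : L2 k :=
  Lam (L2 k) (fun i => sceval (nth (SCconst 0) (rcons px.1 px.2) i)).

Definition scval (P : scalg R) : L2 0 := Lam (L2 0) (fun _ => sceval P).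

Definition nabla_alg n (P : scalg R) (t : n.-tuple mR) : L2 n :=
  \sum_(px <- itgrad t P) tensval n px.

Definition D_alg n (P : scalg R) (t : n.-tuple mR) : L2 n :=
  n`!%:R *: nabla_alg P t.

(* M_2^{n,n+1} = L^2(R_+^n; L^2(SC^{(x)(n+1)})), by representatives. *)
Definition M2norm2 n (G : n.-tuple mR -> L2 n) : \bar R :=
  (\int[@leb R n]_(t in @Rplusn R n) (hnorm2 (G t))%:E)%E.

Definition M2 n (G : n.-tuple mR -> L2 n) : Prop :=
  strongly_measurable (@Rplusn R n) G /\ (M2norm2 G < +oo)%E.

(* "G represents T F", for T the closure of an operator T0 defined on SC_alg. *)
Definition closure_of n (T0 : scalg R -> n.-tuple mR -> L2 n)
    (F : L2 0) (G : n.-tuple mR -> L2 n) : Prop :=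
  M2 G /\ exists P : nat -> scalg R,
    hcvg (fun m => scval (P m)) F /\
    M2norm2 (fun t => T0 (P m) t - G t) @[m --> \oo] --> 0%E.

Definition is_nabla n := closure_of (@nabla_alg n).
Definition is_D n := closure_of (@D_alg n).

Definition sobolev_norm2 k (P : scalg R) : \bar R :=
  ((hnorm2 (scval P))%:E + \sum_(1 <= j < k.+1) M2norm2 (@D_alg j P))%E.

(* The completion of SC_alg for the norm above, inside L^2(SC): limits in
   L^2(SC) of sequences of SC_alg that are Cauchy for this norm. *)
Definition Dk2sigma k (F : L2 0) : Prop :=
  exists P : nat -> scalg R, hcvg (fun m => scval (P m)) F /\
    forall e : R, 0 < e -> exists N, forall p q, (N <= p)%N -> (N <= q)%N ->
      (sobolev_norm2 k (SCsub (P p) (P q)) < e%:E)%E.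

Definition Dinf2sigma (F : L2 0) : Prop :=
  forall k, (1 <= k)%N -> Dk2sigma k F.

End malliavin.

(* Main.v *)
(* SC_alg is spanned by words S(h_1)...S(h_k), and nabla of a word is the sum,
   over the ways to write it as u h v, of h(t) u (x) v. So both sides of the
   identity can be computed on words. By the relations l(h)^* l(k) = <k, h> and
   l(h)^* Omega = 0, the n-th chaos component of a word w applied to Omega is
   the vector v_n(w) given by v_0(w) = tau(w) Omega and
   v_(n+1)(w) = sum over w = u h v of tau(u) l(h) v_n(v). This follows by
   induction on w from the Schwinger-Dyson equation
   tau(k w) = sum over w = u h v of <h, k> tau(u) tau(v), itself the case of
   degree one for w, and from the coassociativity of w |-> sum u (x) h (x) v.
   Since the kernel of v_n(w) is the trace of nabla^n w, the identity holds on
   SC_alg. It passes to the closure because the chaos projections and the trace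
   are contractions. The derivative of F exists because L^2(R_+^n; H) is
   complete; a limit of a Cauchy sequence is obtained directly as an almost
   everywhere limit of simple functions. *)
Require Import Defs.
From mathcomp Require Import all_boot all_order all_algebra complex.
From mathcomp Require Import all_classical all_reals all_analysis.
From mathcomp Require Import measurable_realfun ring lra.

Set Implicit Arguments.
Unset Strict Implicit.
Unset Printing Implicit Defensive.
Import Order.TTheory GRing.Theory Num.Theory.
Import numFieldNormedType.Exports.
Local Open Scope classical_set_scope.
Local Open Scope ring_scope.

(** * Inner products *)

(** The derivative is defined on expressions, while the S(h) satisfy relations in SC_alg. Everything
    is therefore evaluated through [ext], the linear extension of a function of words: the identity
    is proved expression by expression, and only values in L^2 enter the limit. On words two
    statements depend on each other. The chaos expansion of h w uses the Schwinger-Dyson equation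
    for h followed by words no longer than w, and that equation for h u uses the chaos expansion of
    u. One induction on length gives both. In the recursion for v_n, h is the leftmost letter that
    survives as a tensor factor, and the prefix u before it is contracted to tau(u). Creation puts h
    in front, and the first derivative also marks the leftmost letter, so the variables come in the
    same order on both sides and no symmetrization occurs; 1/n! only undoes the factor in D^n. The
    limit is quantitative: for every expression P, the L^2 distance from f_n to the trace kernel of
    P is at most the distance from F to P, for every n. *)

Lemma linear_morphs (A : pzRingType) (V W : lmodType A) (f : V -> W) : linear f ->
  [/\ f 0 = 0, {morph f : x y / x + y} & forall a, {morph f : x / a *: x}].
Proof.
move=> fL.
have f0 : f 0 = 0 by have := fL (-1) 0 0; rewrite scaler0 addr0 scaleN1r addNr.
split => // [x y|a x]; first by have := fL 1 x y; rewrite !scale1r.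
by have := fL a x 0; rewrite f0 !addr0.
Qed.

Lemma linear_sub (A : pzRingType) (V W : lmodType A) (f : V -> W) x y :
  linear f -> f (x - y) = f x - f y.
Proof. by move=> /linear_morphs[_ fD fZ]; rewrite fD -scaleN1r fZ scaleN1r. Qed.

Section complex_facts.
Variable R : realType.
Implicit Types z w : R[i].

Lemma ReD z w : complex.Re (z + w) = complex.Re z + complex.Re w.
Proof. by case: z w => [a b] [c d]. Qed.

Lemma ImD z w : complex.Im (z + w) = complex.Im z + complex.Im w.
Proof. by case: z w => [a b] [c d]. Qed.

Lemma ReM z w : complex.Re (z * w) =
  complex.Re z * complex.Re w - complex.Im z * complex.Im w.
Proof. by case: z w => [a b] [c d]. Qed.

Lemma ImM z w : complex.Im (z * w) =
  complex.Re z * complex.Im w + complex.Im z * complex.Re w.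
Proof. by case: z w => [a b] [c d]. Qed.

Lemma ReN z : complex.Re (- z) = - complex.Re z.
Proof. by case: z. Qed.

Lemma ImN z : complex.Im (- z) = - complex.Im z.
Proof. by case: z. Qed.

Lemma Re_conj z : complex.Re (Num.conj z) = complex.Re z.
Proof. by case: z. Qed.

Lemma Im_conj z : complex.Im (Num.conj z) = - complex.Im z.
Proof. by case: z. Qed.

Lemma mulc_conj z : z * Num.conj z = (sqnormc z)%:C%C.
Proof.
case: z => a b; apply/eqP; rewrite eq_complex /sqnormc /=.
by apply/andP; split; apply/eqP; ring.
Qed.

Lemma sqnormc_ge0 z : 0 <= sqnormc z.
Proof. by rewrite addr_ge0// sqr_ge0. Qed.

Lemma sqnormcM z w : sqnormc (z * w) = sqnormc z * sqnormc w.
Proof. by case: z w => [a b] [c d]; rewrite /sqnormc /=; ring. Qed.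

Lemma sqnormcD_le z w : sqnormc (z + w) <= 2 * sqnormc z + 2 * sqnormc w.
Proof.
case: z w => [a b] [c d]; rewrite /sqnormc /=.
have := sqr_ge0 (a - c); have := sqr_ge0 (b - d); rewrite !expr2; lra.
Qed.

Lemma sqnormc_eq0 z : sqnormc z = 0 -> z = 0.
Proof.
case: z => a b /eqP; rewrite /sqnormc /= paddr_eq0 ?sqr_ge0// !sqrf_eq0.
by case/andP => /eqP -> /eqP ->.
Qed.

End complex_facts.

Section inner_product.
Variables (R : realType) (H : hilbert R).

(* [hdot H] has its arguments and values in structures over the number domain
   underlying [R[i]]; [hip] retypes it so that [0], [+] and [*:] are inferred
   in [H] itself. *)
Definition hip (x y : H) : R[i] := hdot H x y.

Lemma hnorm2E (x : H) : hnorm2 x = complex.Re (hip x x).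
Proof. by []. Qed.

End inner_product.

Section hilbert_facts.
Variables (R : realType) (H : hilbert R).
Implicit Types (x y z : H) (a : R[i]).

Lemma hipDl x y z : hip (x + y) z = hip x z + hip y z.
Proof. exact: (linearDl (hdot H)). Qed.

Lemma hipDr x y z : hip x (y + z) = hip x y + hip x z.
Proof. exact: (linearDr (hdot H)). Qed.

Lemma hipZl a x y : hip (a *: x) y = a * hip x y.
Proof. exact: (linearZl_LR (hdot H)). Qed.

Lemma hipZr a x y : hip x (a *: y) = Num.conj a * hip x y.
Proof. exact: (linearZr_LR (hdot H)). Qed.

Lemma hip0l x : hip 0 x = 0.
Proof. exact: (linear0l (hdot H)). Qed.

Lemma hip0r x : hip x 0 = 0.
Proof. exact: (linear0r (hdot H)). Qed.

Lemma hipBl x y z : hip (x - y) z = hip x z - hip y z.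
Proof. exact: (linearBl (hdot H)). Qed.

Lemma hipBr x y z : hip x (y - z) = hip x y - hip x z.
Proof. exact: (linearBr (hdot H)). Qed.

Lemma hip_suml I (r : seq I) (P : pred I) (F : I -> H) x :
  hip (\sum_(i <- r | P i) F i) x = \sum_(i <- r | P i) hip (F i) x.
Proof. exact: (linear_sumlz (hdot H)). Qed.

Lemma hipC x y : hip x y = Num.conj (hip y x).
Proof. by rewrite /hip hermC expr0 mul1r. Qed.

Lemma hipxx x : hip x x = (hnorm2 x)%:C%C.
Proof.
have := dnorm_ge0 (hdot H) x; rewrite -/(hip x x) hnorm2E.
by case: (hip x x) => a b; rewrite lecE /= => /andP[/eqP -> _].
Qed.

Lemma hnorm2_ge0 x : 0 <= hnorm2 x.
Proof. by have := dnorm_ge0 (hdot H) x; rewrite -/(hip x x) hipxx lecR. Qed.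

Lemma hnorm2_eq0 x : hnorm2 x = 0 -> x = 0.
Proof.
by move=> x0; apply/eqP; rewrite -(dnorm_eq0 (hdot H)) -/(hip x x) hipxx x0.
Qed.

Lemma hnorm_ge0 x : 0 <= hnorm x.
Proof. exact: sqrtr_ge0. Qed.

Lemma sqr_hnorm x : hnorm x ^+ 2 = hnorm2 x.
Proof. by rewrite sqr_sqrtr// hnorm2_ge0. Qed.

Lemma hnorm_eq0 x : hnorm x = 0 -> x = 0.
Proof. by move=> x0; apply: hnorm2_eq0; rewrite -sqr_hnorm x0 expr0n. Qed.

Lemma hnorm20 : hnorm2 (0 : H) = 0.
Proof. by rewrite hnorm2E hip0l. Qed.

Lemma hnorm0 : hnorm (0 : H) = 0.
Proof. by rewrite /hnorm /dotnorm -/(hnorm2 _) hnorm20 sqrtr0. Qed.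

Lemma hnorm2Z a x : hnorm2 (a *: x) = sqnormc a * hnorm2 x.
Proof.
apply: (@complexI R); rewrite -hipxx hipZl hipZr mulrA mulc_conj hipxx.
by rewrite rmorphM.
Qed.

Lemma hnorm2D x y :
  hnorm2 (x + y) = hnorm2 x + 2 * complex.Re (hip x y) + hnorm2 y.
Proof.
rewrite !hnorm2E hipDl !hipDr !ReD (hipC y x) Re_conj; ring.
Qed.

Lemma hnorm2N x : hnorm2 (- x) = hnorm2 x.
Proof. by rewrite -scaleN1r hnorm2Z /sqnormc /= sqrrN oppr0 expr1n expr0n addr0 mul1r. Qed.

Lemma hnormN x : hnorm (- x) = hnorm x.
Proof. by rewrite /hnorm /dotnorm -/(hnorm2 _) hnorm2N. Qed.

Lemma hnormB x y : hnorm (x - y) = hnorm (y - x).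
Proof. by rewrite -hnormN opprB. Qed.

Lemma hnorm2D_le x y : hnorm2 (x + y) <= 2 * hnorm2 x + 2 * hnorm2 y.
Proof.
have := hnorm2_ge0 (x - y); rewrite !hnorm2D hnorm2N.
rewrite (_ : hip x (- y) = - hip x y) ?ReN; last by rewrite -sub0r hipBr hip0r sub0r.
lra.
Qed.

Lemma hnormZ a x : hnorm (a *: x) = Num.sqrt (sqnormc a) * hnorm x.
Proof. by rewrite /hnorm /dotnorm -/(hnorm2 _) hnorm2Z sqrtrM ?sqnormc_ge0. Qed.

Lemma hnormZr (r : R) x : hnorm (r%:C%C *: x) = `|r| * hnorm x.
Proof. by rewrite hnormZ /sqnormc /= expr0n addr0 sqrtr_sqr. Qed.

Lemma Re_hip_le x y : complex.Re (hip x y) <= hnorm x * hnorm y.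
Proof.
have [x0|x_neq0] := eqVneq (hnorm x) 0.
  by rewrite (hnorm_eq0 x0) hip0l hnorm0 mul0r.
have [y0|y_neq0] := eqVneq (hnorm y) 0.
  by rewrite (hnorm_eq0 y0) hip0r hnorm0 mulr0.
have x_gt0 : 0 < hnorm x by rewrite lt_neqAle eq_sym x_neq0 hnorm_ge0.
have y_gt0 : 0 < hnorm y by rewrite lt_neqAle eq_sym y_neq0 hnorm_ge0.
(* This vector has squared norm 2|x||y| (|x||y| - Re<x, y>); zero norms were set aside so that the
   factor |x||y| can be cancelled. *)
have := hnorm2_ge0 ((hnorm y)%:C%C *: x - (hnorm x)%:C%C *: y).
rewrite hnorm2D hnorm2N !hnorm2Z -scaleNr hipZl hipZr /sqnormc /= -!sqr_hnorm.
set p := hnorm x in x_gt0 *; set q := hnorm y in y_gt0 *.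
case: (hip x y) => c d /=.
have pq_gt0 : 0 < p * q by rewrite mulr_gt0.
move=> h; rewrite -(ler_pM2l pq_gt0); rewrite !expr2 in h *; nra.
Qed.

Lemma hnormD_le x y : hnorm (x + y) <= hnorm x + hnorm y.
Proof.
rewrite -(@ler_pXn2r _ 2)// ?nnegrE ?addr_ge0 ?hnorm_ge0//.
rewrite sqr_hnorm hnorm2D sqrrD !sqr_hnorm lerD2r lerD2l.
by rewrite -[leRHS]mulr_natl ler_pM2l// Re_hip_le.
Qed.

(* [Re_hip_le] for the vectors [conj <x, y> *: x] and [y]. *)
Lemma sqnormc_hip_le x y : sqnormc (hip x y) <= hnorm2 x * hnorm2 y.
Proof.
have := Re_hip_le (Num.conj (hip x y) *: x) y.
rewrite hipZl mulrC mulc_conj /= hnormZ.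
rewrite (_ : sqnormc (Num.conj _) = sqnormc (hip x y)); last first.
  by rewrite /sqnormc Re_conj Im_conj sqrrN.
rewrite -!sqr_hnorm.
set s := sqnormc _; have s_ge0 : 0 <= s := sqnormc_ge0 _.
move=> h.
have [s0|s_neq0] := eqVneq s 0; first by rewrite s0 mulr_ge0 ?sqr_ge0.
have ss : Num.sqrt s ^+ 2 = s by rewrite sqr_sqrtr.
have q_gt0 : 0 < Num.sqrt s by rewrite sqrtr_gt0 lt_neqAle eq_sym s_neq0.
have : Num.sqrt s <= hnorm x * hnorm y.
  by rewrite -(ler_pM2l q_gt0) -expr2 ss mulrA.
move=> {}h; rewrite -exprMn -ss.
by rewrite ler_pXn2r// ?nnegrE ?mulr_ge0 ?hnorm_ge0// ltW.
Qed.

Lemma hcvg_dist_le (u : nat -> H) (l : H) (B : nat -> R) :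
  (forall n, hnorm (u n - l) <= B n) -> B @ \oo --> (0 : R) -> hcvg u l.
Proof.
move=> uB B0; apply: (@squeeze_cvgr _ _ _ _ (fun=> 0) B) => //.
- by near=> n; rewrite hnorm_ge0 uB.
- exact: cvg_cst.
Unshelve. all: by end_near. Qed.

Lemma hcvgD (u v : nat -> H) (k l : H) : hcvg u k -> hcvg v l ->
  hcvg (fun n => u n + v n) (k + l).
Proof.
move=> uk vl; apply: (@hcvg_dist_le _ _ (fun n => hnorm (u n - k) + hnorm (v n - l))).
  by move=> n; rewrite opprD addrACA hnormD_le.
by rewrite -[0]addr0; exact: cvgD.
Qed.

Lemma hcvgZ (u : nat -> H) (l : H) a : hcvg u l ->
  hcvg (fun n => a *: u n) (a *: l).
Proof.
move=> ul; apply: (@hcvg_dist_le _ _ (fun n => Num.sqrt (sqnormc a) * hnorm (u n - l))).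
  by move=> n; rewrite -scalerBr hnormZ.
by rewrite -(mulr0 (Num.sqrt (sqnormc a))); exact: cvgMr.
Qed.

Lemma hcvg_cst (l : H) : hcvg (fun=> l) l.
Proof. by rewrite /hcvg subrr hnorm0; exact: cvg_cst. Qed.

End hilbert_facts.

(** * Words in the generators *)

(** Membership is [List.In] because words and expressions carry no [eqType] structure, on which the
    boolean membership relies. *)
Lemma In_cat T (x : T) (r s : seq T) :
  List.In x (r ++ s) -> List.In x r \/ List.In x s.
Proof. exact: List.in_app_or. Qed.

Lemma eq_big_In (V : nmodType) I (r : seq I) (F G : I -> V) :
  (forall i, List.In i r -> F i = G i) -> \sum_(i <- r) F i = \sum_(i <- r) G i.
Proof.
elim: r => [|i r IH] FG; first by rewrite !big_nil.
by rewrite !big_cons FG ?IH//=; [move=> j ?; apply: FG; right|left].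
Qed.

Section words.
Variable R : realType.
Local Notation word := (seq (L2R R)).

(* [ext P phi] is the value at [P] of the linear extension of [phi] from words
   in the generators to the free algebra. *)
Fixpoint ext (V : lmodType R[i]) (P : scalg R) (phi : word -> V) : V :=
  match P with
  | SCconst c => c *: phi [::]
  | SCgen h => phi [:: h]
  | SCadd A B => ext A phi + ext B phi
  | SCmul A B => ext A (fun u => ext B (fun v => phi (u ++ v)))
  end.

(** The multilinear counterpart of [ext]: an elementary tensor of expressions is expanded into
    tensors of words. *)
Fixpoint extl (V : lmodType R[i]) (l : seq (scalg R)) (Th : seq word -> V) : V :=
  match l with
  | [::] => Th [::]
  | P :: l' => ext P (fun u => extl l' (fun us => Th (u :: us)))
  end.

(** The free difference quotient on words, with the removed letter recorded in the middle. *)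
Fixpoint splits (w : word) : seq (word * L2R R * word) :=
  match w with
  | [::] => [::]
  | h :: v => ([::], h, v) :: [seq (h :: s.1.1, s.1.2, s.2) | s <- splits v]
  end.

(* The iterated derivative of a word, where [Th] interprets the tensor
   [u_0 (x) ... (x) u_n] of words. *)
Fixpoint wnabla (V : lmodType R[i]) (ts : seq R) (Th : seq word -> V)
    (w : word) : V :=
  match ts with
  | [::] => Th [:: w]
  | t :: ts' => \sum_(s <- splits w)
      (s.1.2 t)%:C%C *: wnabla ts' (fun l => Th (s.1.1 :: l)) s.2
  end.

Lemma splits_cat (a b : word) : splits (a ++ b) =
  [seq (s.1.1, s.1.2, s.2 ++ b) | s <- splits a] ++
  [seq (a ++ s.1.1, s.1.2, s.2) | s <- splits b].
Proof.
elim: a => [|h a IH] /=; first by rewrite (eq_map (g := id)) ?map_id// => -[[]].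
by rewrite IH map_cat -!map_comp.
Qed.

Section linear_extension.
Variables (V W : lmodType R[i]).

Lemma ext_linear P (a : R[i]) (phi psi : word -> V) :
  ext P (fun w => a *: phi w + psi w) = a *: ext P phi + ext P psi.
Proof.
elim: P phi psi => [c|h|A IHA B IHB|A IHA B IHB] phi psi //=.
- by rewrite scalerDr !scalerA mulrC.
- by rewrite IHA IHB scalerDr addrACA.
- by rewrite -IHA; congr ext; apply/funext => u; rewrite IHB.
Qed.

Lemma ext0 P : ext P (fun=> 0 : V) = 0.
Proof.
have := ext_linear P (-1) (fun=> 0) (fun=> 0 : V).
by rewrite scaler0 addr0 scaleN1r addNr.
Qed.

Lemma extD P (phi psi : word -> V) :
  ext P (fun w => phi w + psi w) = ext P phi + ext P psi.
Proof.
rewrite -[ext P phi]scale1r -ext_linear; congr ext.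
by apply/funext => w; rewrite scale1r.
Qed.

Lemma extZ P (a : R[i]) (phi : word -> V) :
  ext P (fun w => a *: phi w) = a *: ext P phi.
Proof.
by rewrite -[RHS]addr0 -(ext0 P) -ext_linear; congr ext; apply/funext => w; rewrite addr0.
Qed.

Lemma ext_sum P I (r : seq I) (F : I -> word -> V) :
  ext P (fun w => \sum_(i <- r) F i w) = \sum_(i <- r) ext P (F i).
Proof.
elim: r => [|i r IH].
  by rewrite big_nil -[RHS](ext0 P); congr ext; apply/funext => w; rewrite big_nil.
by rewrite big_cons -IH -extD; congr ext; apply/funext => w; rewrite big_cons.
Qed.

Lemma ext_morph P (f : V -> W) (phi : word -> V) :
  linear f -> f (ext P phi) = ext P (f \o phi).
Proof.
move=> fL.
have [_ fD fZ] := linear_morphs fL.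
elim: P phi => [c|h|A IHA B IHB|A IHA B IHB] phi //=; [exact: fZ|by rewrite fD IHA IHB|].
by rewrite IHA; congr ext; apply/funext => u; rewrite /= IHB.
Qed.

Lemma extl_sum l I (r : seq I) (F : I -> seq word -> V) :
  extl l (fun ws => \sum_(i <- r) F i ws) = \sum_(i <- r) extl l (F i).
Proof.
elim: l F => [|P l IH] F //=; rewrite -ext_sum; congr ext.
by apply/funext => u; rewrite IH.
Qed.

Lemma extl_rcons l P (Th : seq word -> V) :
  extl (rcons l P) Th = extl l (fun us => ext P (fun w => Th (rcons us w))).
Proof.
elim: l Th => [|Q l IH] Th //=; congr ext.
by apply/funext => u; rewrite IH.
Qed.

Lemma wnabla_morph (f : V -> W) ts (Th : seq word -> V) w :
  linear f -> f (wnabla ts Th w) = wnabla ts (f \o Th) w.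
Proof.
move=> fL.
have [f0 _ _] := linear_morphs fL.
elim: ts Th w => [|t ts IH] Th w //=.
elim: (splits w) => [|s l IHl]; first by rewrite !big_nil f0.
by rewrite !big_cons fL IHl IH.
Qed.

(** Differentiating an expression and then expanding agrees with expanding and then splitting words.
    Only the product has content: there the two halves of the Leibniz rule are the two halves of
    [splits_cat], in opposite order. *)
Lemma ext_grad (t : R) P (phi : word -> word -> V) :
  \sum_(xy <- grad t P) ext xy.1 (fun u => ext xy.2 (phi u)) =
  ext P (fun w => \sum_(s <- splits w) (s.1.2 t)%:C%C *: phi s.1.1 s.2).
Proof.
elim: P phi => [c|h|A IHA B IHB|A IHA B IHB] phi /=.
- by rewrite !big_nil scaler0.
- by rewrite !big_seq1 /= scale1r.
- by rewrite big_cat /= IHA IHB.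
rewrite big_cat /= !big_map /= -ext_sum.
under [X in ext A X]eq_fun => a do rewrite (IHB (fun u => phi (a ++ u))).
rewrite (IHA (fun u v => ext B (fun b => phi u (v ++ b)))) -extD; congr ext.
apply/funext => a; under [X in _ + X]eq_bigr do rewrite -extZ.
rewrite -ext_sum -extD; congr ext; apply/funext => b.
by rewrite splits_cat big_cat !big_map /= addrC.
Qed.

(** The starting family [T] is arbitrary so that induction on [ts] goes through [foldl]; the words
    [us] come from the factors that are already closed to differentiation. *)
Lemma extl_itgrad (ts : seq R) T (Th : seq word -> V) :
  \sum_(px <- foldl (fun T t => flatten [seq grad_last t px | px <- T]) T ts)
    extl (rcons px.1 px.2) Th =
  \sum_(px <- T) extl px.1 (fun us =>
    ext px.2 (wnabla ts (fun l => Th (us ++ l)))).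
Proof.
elim: ts T => [|t ts IH] T /=.
  apply: eq_bigr => px _; rewrite extl_rcons; congr extl.
  by apply/funext => us; congr ext; apply/funext => w; rewrite cats1.
rewrite IH big_flatten big_map; apply: eq_bigr => -[p x] _ /=.
rewrite /grad_last big_map /=.
under eq_bigr do rewrite extl_rcons.
rewrite -extl_sum; congr extl; apply/funext => us /=.
rewrite -(ext_grad t x (fun u => wnabla ts (fun l => Th (us ++ u :: l)))).
apply: eq_bigr => uv _; congr ext; apply/funext => u; congr ext.
by congr wnabla; apply/funext => l; rewrite cat_rcons.
Qed.

End linear_extension.
End words.

(** * Elements of SC represented by words *)

Section operators.
Variables (R : realType) (Fk : fock R).
Local Notation word := (seq (L2R R)).
Implicit Types (X Y : Fk -> Fk).

Definition wop (w : word) : Fk -> Fk := foldr (fun h X => @Sop R Fk h \o X) id w.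

Lemma wop_cat u v : wop (u ++ v) = wop u \o wop v.
Proof. by elim: u => [|h u IH] //=; rewrite IH. Qed.

Lemma bounded_op_id : bounded_op (id : Fk -> Fk).
Proof. by split => //; exists 1 => x; rewrite mul1r. Qed.

Lemma bounded_op_ge0 X : bounded_op X ->
  exists2 M : R, 0 <= M & forall x, hnorm (X x) <= M * hnorm x.
Proof.
move=> [_ [M XM]]; exists `|M| => // x; rewrite (le_trans (XM x))//.
by rewrite ler_wpM2r ?hnorm_ge0// ler_norm.
Qed.

Lemma bounded_op_comp X Y : bounded_op X -> bounded_op Y -> bounded_op (X \o Y).
Proof.
move=> bX bY; split; first by move=> a x y /=; rewrite bY.1 bX.1.
have [M M0 XM] := bounded_op_ge0 bX; have [N _ YN] := bounded_op_ge0 bY.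
exists (M * N) => x /=; rewrite (le_trans (XM _))// -mulrA.
by rewrite ler_wpM2l.
Qed.

Lemma bounded_opD X Y : bounded_op X -> bounded_op Y ->
  bounded_op (fun psi => X psi + Y psi).
Proof.
move=> bX bY; split.
  by move=> a x y /=; rewrite bX.1 bY.1 scalerDr addrACA.
have [M _ XM] := bounded_op_ge0 bX; have [N _ YN] := bounded_op_ge0 bY.
exists (M + N) => x /=.
by rewrite (le_trans (hnormD_le _ _))// mulrDl lerD.
Qed.

Lemma bounded_opZ (a : R[i]) X : bounded_op X ->
  bounded_op (fun psi => a *: X psi).
Proof.
move=> bX; split.
  by move=> b x y /=; rewrite bX.1 scalerDr !scalerA mulrC.
have [M _ XM] := bounded_op_ge0 bX.
exists (Num.sqrt (sqnormc a) * M) => x /=.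
by rewrite hnormZ -mulrA ler_wpM2l ?sqrtr_ge0.
Qed.

Lemma bounded_Sop h : bounded_op (@Sop R Fk h).
Proof.
have hL := L2R_prop h.
exact: bounded_opD (creation_bounded _ hL) (annihilation_bounded _ hL).
Qed.

Lemma SC_id : SC (id : Fk -> Fk).
Proof. by split => //; exact: bounded_op_id. Qed.

Lemma SC_Sop h : SC (@Sop R Fk h).
Proof. by split => [|Y _ YS]; [exact: bounded_Sop|rewrite YS]. Qed.

Lemma SC_comp X Y : SC X -> SC Y -> SC (X \o Y).
Proof.
move=> [bX cX] [bY cY]; split => [|Z bZ cZ]; first exact: bounded_op_comp.
rewrite -compA (cY Z bZ cZ) compA (cX Z bZ cZ) //.
Qed.

Lemma SC_linear (a : R[i]) X Y : SC X -> SC Y -> SC (fun psi => a *: X psi + Y psi).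
Proof.
move=> [bX cX] [bY cY]; split => [|Z bZ cZ].
  by apply: bounded_opD => //; exact: bounded_opZ.
apply/funext => psi /=; have [_ ZD ZZ] := linear_morphs bZ.1.
by rewrite ZD ZZ -[X (Z psi)]/((X \o Z) psi) cX// -[Y (Z psi)]/((Y \o Z) psi) cY.
Qed.

Lemma SC_wop w : SC (wop w).
Proof. by elim: w => [|h w IH]; [exact: SC_id|exact: SC_comp (SC_Sop h) IH]. Qed.

Lemma SC_sceval P : SC (@sceval R Fk P).
Proof.
elim: P => [c|h|A IHA B IHB|A IHA B IHB] /=.
(* A scalar c is written (c - 1) id + id, because [SC_linear] combines two elements of SC. *)
- have := SC_linear (c - 1) SC_id SC_id; congr SC; apply/funext => psi.
  by rewrite -{2}[psi]scale1r -scalerDl subrK.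
- exact: SC_Sop.
- have := SC_linear 1 IHA IHB; congr SC; apply/funext => psi.
  by rewrite scale1r.
- exact: SC_comp.
Qed.

Definition linear_on_SC (V : lmodType R[i]) (l : (Fk -> Fk) -> V) : Prop :=
  forall (a : R[i]) X Y, SC X -> SC Y ->
    l (fun psi => a *: X psi + Y psi) = a *: l X + l Y.

(** [Lam] is linear in a factor only among elements of SC, hence the restricted linearity. For a
    product the hypothesis is applied to X |-> l (X o B) and to X |-> l (u o X), which are again
    linear on SC because SC is closed under composition; the second also uses linearity of the
    operator of [u]. *)
Lemma linear_on_SC_sceval (V : lmodType R[i]) (l : (Fk -> Fk) -> V) P :
  linear_on_SC l -> l (sceval P) = ext P (fun w => l (wop w)).
Proof.
elim: P l => [c|h|A IHA B IHB|A IHA B IHB] l lL /=.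
(* Linearity is available on SC only, so zero is presented as - id + id. *)
- have id0 : l (fun=> 0) = 0.
    have /= := lL (-1) _ _ SC_id SC_id; rewrite scaleN1r addNr => <-.
    by congr l; apply/funext => psi; rewrite scaleN1r addNr.
  rewrite -[RHS]addr0 -id0 -lL//; last 2 first.
    exact: SC_id.
    have := SC_linear (-1) SC_id SC_id; congr SC; apply/funext => psi.
    by rewrite scaleN1r addNr.
  by congr l; apply/funext => psi; rewrite addr0.
- by congr l.
- rewrite -IHA// -IHB// -[l (sceval A)]scale1r -lL; [|exact: SC_sceval..].
  by congr l; apply/funext => psi; rewrite scale1r.
- rewrite (IHA (fun X => l (X \o sceval B))); last first.
    move=> a X Y SX SY; rewrite -lL//; last 2 first.
    + exact: SC_comp SX (SC_sceval B).
    + exact: SC_comp SY (SC_sceval B).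
  congr ext; apply/funext => u; rewrite (IHB (fun X => l (wop u \o X))); last first.
    move=> a X Y SX SY; rewrite -lL//; last 2 first.
    + exact: SC_comp (SC_wop u) SX.
    + exact: SC_comp (SC_wop u) SY.
    by congr l; apply/funext => psi /=; rewrite (SC_wop u).1.1.
  by congr ext; apply/funext => v; rewrite wop_cat.
Qed.

Lemma sceval_ext P psi : sceval P psi = ext P (fun w => wop w psi).
Proof. by rewrite (linear_on_SC_sceval P (l := fun X => X psi)). Qed.

Lemma Lam_sceval k (L : L2SC Fk k) l : size l = k.+1 ->
  Lam L (fun i => sceval (nth (SCconst 0) l i)) =
  extl l (fun ws => Lam L (fun i => wop (nth [::] ws i))).
Proof.
(* The factors are expanded from left to right: [ps] holds the operators of the words already
   chosen, [l] the expressions still to be expanded. *)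
have gen : forall l ps, (size ps + size l)%N = k.+1 -> (forall X, List.In X ps -> SC X) ->
    Lam L (fun i => nth id (ps ++ [seq sceval P | P <- l]) i) =
    extl l (fun ws => Lam L (fun i => nth id (ps ++ [seq wop w | w <- ws]) i)).
  elim => [|P {}l IH] ps //= sz SCps.
  have psk : (size ps < k.+1)%N by rewrite -sz addnS ltnS leq_addr.
  pose i0 := Ordinal psk.
  (* The current factor is replaced by [id], which puts the family in the shape required by
     [Lam_linear], with one free position [i0]. *)
  pose X (j : 'I_k.+1) := nth id (ps ++ id :: [seq sceval P | P <- l]) j.
  have SCX j : SC (X j).
    rewrite /X; elim: ps {sz psk i0 X} SCps (nat_of_ord j) => [_|Y ps IHps SCps] [|m] /=.
    - exact: SC_id.
    - have [ml|lm] := ltnP m (size l).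
        by rewrite (nth_map (SCconst 0))//; exact: SC_sceval.
      by rewrite nth_default ?size_map//; exact: SC_id.
    - by apply: SCps; left.
    - by apply: IHps => Z ?; apply: SCps; right.
  have XE A : (fun i : 'I_k.+1 => nth id (ps ++ A :: [seq sceval P | P <- l]) i) =
      (fun j => if j == i0 then A else X j).
    apply/funext => j; rewrite /X -(inj_eq val_inj) /= !nth_cat.
    case: ltngtP => [//|lt|->]; last by rewrite subnn.
    by rewrite -(subnKC lt) addSnnS addKn.
  rewrite XE (linear_on_SC_sceval P (l := fun A => Lam L (fun j => if j == i0 then A else X j))).
    congr ext; apply/funext => u; rewrite -XE -cat_rcons IH.
    - by congr extl; apply/funext => ws; congr Lam; apply/funext => i; rewrite cat_rcons.
    - by rewrite size_rcons addSnnS.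
    - move=> Y; rewrite -cats1 => YS; have [/SCps//|[<-|//]] := In_cat YS.
      exact: SC_wop.
  by move=> a A B SA SB; exact: Lam_linear.
move=> sz; have := gen l [::] sz (fun X => False_ind _) => /=.
rewrite (_ : (fun i : 'I_k.+1 => nth id _ i) = (fun i => sceval (nth (SCconst 0) l i))); last first.
  by apply/funext => i; rewrite (nth_map (SCconst 0)) ?sz.
move=> ->; congr extl; apply/funext => ws; congr Lam; apply/funext => i.
have [iw|wi] := ltnP i (size ws); first by rewrite (nth_map [::]).
(* Past the end the two defaults agree, since [wop [::]] is [id]. *)
by rewrite !nth_default ?size_map.
Qed.

End operators.

(** * Integration on R_+^n *)

Section square_integrable_facts.
Context (R : realType) d (T : measurableType d) (mu : {measure set T -> \bar R}).
Variables (D : set T) (mD : measurable D).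
Implicit Types f g : T -> R[i].

Lemma measurable_sqnormc f :
  measurable_fun D (fun t => complex.Re (f t)) ->
  measurable_fun D (fun t => complex.Im (f t)) ->
  measurable_fun D (fun t => sqnormc (f t)).
Proof.
move=> mRe mIm; rewrite /sqnormc.
by apply: measurable_funD; exact: measurable_funX.
Qed.

Lemma sqint_integrable f : sqint mu D f ->
  mu.-integrable D (fun t => (sqnormc (f t))%:E).
Proof.
move=> [mRe mIm foo]; apply/integrableP; split.
  by apply/measurable_EFinP; exact: measurable_sqnormc.
under eq_integral do rewrite gee0_abs ?lee_fin ?sqnormc_ge0//.
exact: foo.
Qed.

Lemma measurable_ReIm_lin (a : R[i]) f g : sqint mu D f -> sqint mu D g ->
  measurable_fun D (fun t => complex.Re (a * f t + g t)) /\
  measurable_fun D (fun t => complex.Im (a * f t + g t)).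
Proof.
move=> [fRe fIm _] [gRe gIm _]; split.
  under eq_fun do rewrite ReD ReM.
  by apply: measurable_funD => //; apply: measurable_funB;
    apply: measurable_funM => //; exact: measurable_cst.
under eq_fun do rewrite ImD ImM.
by apply: measurable_funD => //; apply: measurable_funD;
  apply: measurable_funM => //; exact: measurable_cst.
Qed.

Lemma sqint_lin (a : R[i]) f g : sqint mu D f -> sqint mu D g ->
  sqint mu D (fun t => a * f t + g t).
Proof.
move=> sf sg; have [mRe mIm] := measurable_ReIm_lin a sf sg; split => //.
have := integrableD mD (integrableZl mD (2 * sqnormc a) (sqint_integrable sf))
  (integrableZl mD 2 (sqint_integrable sg)).
move=> /(integrable_lty mD); apply: le_lt_trans.
apply: ge0_le_integral => //.
- by move=> t _; rewrite lee_fin sqnormc_ge0.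
- by apply/measurable_EFinP; exact: measurable_sqnormc.
- by apply/measurable_EFinP; apply: measurable_funD; apply: measurable_funM => //;
    apply: measurable_sqnormc; [case: sf|case: sf|case: sg|case: sg].
move=> t Dt; rewrite -!EFinM -EFinD lee_fin (le_trans (sqnormcD_le _ _))//.
by rewrite sqnormcM mulrA.
Qed.

Lemma sqint0 : sqint mu D (fun=> 0).
Proof.
split; [exact: measurable_cst|exact: measurable_cst|].
by under eq_integral do rewrite /sqnormc /= expr0n addr0; rewrite integral0.
Qed.

Lemma sqint_sum I (r : seq I) (c : I -> R[i]) (F : I -> T -> R[i]) :
  (forall i, sqint mu D (F i)) -> sqint mu D (fun t => \sum_(i <- r) c i * F i t).
Proof.
move=> sF; elim: r => [|i r IH].
  by under eq_fun do rewrite big_nil; exact: sqint0.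
by under eq_fun do rewrite big_cons; exact: sqint_lin.
Qed.

Lemma sqintM_integrable f g : sqint mu D f -> sqint mu D g ->
  mu.-integrable D (EFin \o (fun t => complex.Re (f t * Num.conj (g t)))) /\
  mu.-integrable D (EFin \o (fun t => complex.Im (f t * Num.conj (g t)))).
Proof.
move=> sf sg; have [fRe fIm _] := sf; have [gRe gIm _] := sg.
have isum := integrableD mD (sqint_integrable sf) (sqint_integrable sg).
(* A crude domination by the sum of two squared moduli, which is integrable; it serves both the real
   and the imaginary part. *)
have key (a b c e : R) : `|a * c + b * e| <= a ^+ 2 + b ^+ 2 + (c ^+ 2 + e ^+ 2).
  rewrite ler_norml; apply/andP; split; rewrite !expr2.
    have := sqr_ge0 (a + c); have := sqr_ge0 (b + e); rewrite !expr2.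
    have := sqr_ge0 (a - c); have := sqr_ge0 (b - e); rewrite !expr2; nra.
  have := sqr_ge0 (a + c); have := sqr_ge0 (b + e); rewrite !expr2.
  have := sqr_ge0 (a - c); have := sqr_ge0 (b - e); rewrite !expr2; nra.
split; apply: (le_integrable mD _ _ isum).
- apply/measurable_EFinP; under eq_fun do rewrite ReM Re_conj Im_conj mulrN opprK.
  by apply: measurable_funD; exact: measurable_funM.
- move=> t _; rewrite lee_fin [leRHS]ger0_norm; last by apply: addr_ge0; exact: sqnormc_ge0.
  by rewrite ReM Re_conj Im_conj mulrN opprK; exact: key.
- apply/measurable_EFinP; under eq_fun do rewrite ImM Re_conj Im_conj mulrN addrC.
  by apply: measurable_funB; exact: measurable_funM.
- move=> t _; rewrite lee_fin [leRHS]ger0_norm; last by apply: addr_ge0; exact: sqnormc_ge0.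
  rewrite ImM Re_conj Im_conj.
  apply: le_trans (key (complex.Re (f t)) (complex.Im (f t)) _ _) _.
  by rewrite /sqnormc sqrrN; lra.
Qed.

Lemma L2dotxx f : sqint mu D f ->
  L2dot mu D f f = (Rintegral mu D (fun t => sqnormc (f t)))%:C%C.
Proof.
move=> sf; rewrite /L2dot /cintegral.
under eq_Rintegral do rewrite mulc_conj /=.
under [X in (_ +i* X)%C]eq_Rintegral do rewrite mulc_conj /=.
by congr (_ +i* _)%C; rewrite /Rintegral integral0.
Qed.

End square_integrable_facts.

Section fubini_product.
Context (R : realType) d1 d2 (T1 : measurableType d1) (T2 : measurableType d2).
Variables (m1 : {sigma_finite_measure set T1 -> \bar R})
          (m2 : {sigma_finite_measure set T2 -> \bar R}).

Lemma integrable_prodM (a : T1 -> R) (b : T2 -> R) :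
  m1.-integrable setT (EFin \o a) -> m2.-integrable setT (EFin \o b) ->
  (m1 \x m2)%E.-integrable setT (fun p => (a p.1 * b p.2)%:E) /\
  (\int[(m1 \x m2)%E]_p (a p.1 * b p.2)%:E =
    \int[m1]_x (a x)%:E * \int[m2]_y (b y)%:E)%E.
Proof.
move=> ia ib.
have ma := measurable_int _ ia; have mb := measurable_int _ ib.
have mab : measurable_fun setT (fun p : T1 * T2 => (a p.1 * b p.2)%:E).
  apply/measurable_EFinP; apply: measurable_funM.
    by move/measurable_EFinP: ma => ma; exact: measurableT_comp ma measurable_fst.
  by move/measurable_EFinP: mb => mb; exact: measurableT_comp mb measurable_snd.
have fb := integrable_fin_num measurableT ib.
have fb' : (\int[m2]_y (`|b y|)%:E)%E \is a fin_num.
  by have := integrable_fin_num measurableT (integrable_abse ib).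
have iab : (m1 \x m2)%E.-integrable setT (fun p => (a p.1 * b p.2)%:E).
  apply/(integrable12ltyP _ _ mab) => /=.
  under eq_integral.
    move=> x _; under eq_integral do rewrite normrM EFinM.
    rewrite integralZl//; last exact: (integrable_abse ib).
    rewrite -(fineK fb') muleC; over.
  rewrite /= integralZl//; last exact: (integrable_abse ia).
  rewrite lte_mul_pinfty ?lee_fin ?fine_ge0 ?integral_ge0//.
  by move/integrableP : ia => [].
split => //; rewrite -integral12_prod_meas1//.
rewrite /fubini_F /=; under eq_integral.
  move=> x _; under eq_integral do rewrite EFinM.
  rewrite integralZl//= -(fineK fb) muleC; over.
by rewrite /= integralZl// fineK// muleC.
Qed.

End fubini_product.

Section lebesgue_tuple_facts.
Variable R : realType.
Local Notation mR := (measurableTypeR R).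

Lemma measurable_Rplus : measurable (@Rplus R).
Proof.
rewrite (_ : @Rplus R = `[0, +oo[%classic); first exact: measurable_itv.
by apply/seteqP; split => x /=; rewrite in_itv /= andbT.
Qed.

Lemma measurable_Rplusn n : measurable (@Rplusn R n).
Proof.
rewrite (_ : @Rplusn R n = \bigcap_(i in [set: 'I_n]) ((fun t : n.-tuple mR => tnth t i) @^-1` (@Rplus R))).
  apply: fin_bigcap_measurable => // i _.
  rewrite -[X in measurable X]setTI; apply: measurable_tnth => //.
  exact: measurable_Rplus.
by apply/seteqP; split => t /= h i; [move=> _; exact: h|exact: (h i I)].
Qed.

Lemma tuple_eta_cons n (t : n.+1.-tuple R) : t = thead t :: behead t :> seq R.
Proof. by case: t => -[|x s]. Qed.

Lemma tcons_preimage_Rplusn n :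
  @tcons R n @^-1` (@Rplusn R n.+1) = (@Rplus R) `*` (@Rplusn R n).
Proof.
apply/seteqP; split => -[x t] /=.
  move=> h; split => [|i] /=; first by have := h ord0; rewrite tnth0.
  by have := h (lift ord0 i); rewrite tnthS.
by move=> [/= x0 t0] i; case: (unliftP ord0 i) => [j ->|->]; rewrite ?tnthS ?tnth0.
Qed.

Lemma measurable_thead n : measurable_fun [set: n.+1.-tuple mR] (fun t => thead t : mR).
Proof. exact: measurable_tnth. Qed.

Lemma Rplusn_thead n (t : n.+1.-tuple mR) : Rplusn t -> Rplus (thead t).
Proof. by move=> t0; exact: t0. Qed.

Lemma Rplusn_behead n (t : n.+1.-tuple mR) : Rplusn t -> Rplusn [tuple of behead t].
Proof. by move=> t0 i; rewrite tnth_behead; exact: t0. Qed.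

Lemma measurable_fun_thead n (a : mR -> R) : measurable_fun (@Rplus R) a ->
  measurable_fun (@Rplusn R n.+1) (fun t => a (thead t)).
Proof.
move=> ma; apply: (measurable_comp measurable_Rplus _ ma).
  by move=> _ [t t0 <-]; exact: Rplusn_thead.
by apply: measurable_funTS; exact: measurable_thead.
Qed.

Lemma measurable_fun_behead n (b : n.-tuple mR -> R) : measurable_fun (@Rplusn R n) b ->
  measurable_fun (@Rplusn R n.+1) (fun t => b [tuple of behead t]).
Proof.
move=> mb; pose g (t : n.+1.-tuple mR) : n.-tuple mR := [tuple of behead t].
rewrite (_ : (fun t => _) = b \o g)//; apply: (measurable_comp (@measurable_Rplusn n) _ mb).
  by move=> _ [t t0 <-]; exact: Rplusn_behead.
by apply: measurable_funTS; exact: measurable_behead.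
Qed.

(** [leb n.+1] is the image of a product measure under [tcons], so this is Fubini. Both functions
    are extended by zero, which moves the computation from the orthants to the whole spaces. *)
Lemma integrable_tens n (a : mR -> R) (b : n.-tuple mR -> R) :
  (@lebesgue_measure R).-integrable (@Rplus R) (EFin \o a) ->
  (@leb R n).-integrable (@Rplusn R n) (EFin \o b) ->
  (@leb R n.+1).-integrable (@Rplusn R n.+1)
    (fun t => (a (thead t) * b [tuple of behead t])%:E) /\
  Rintegral (@leb R n.+1) (@Rplusn R n.+1) (fun t => a (thead t) * b [tuple of behead t]) =
  Rintegral (@lebesgue_measure R) (@Rplus R) a * Rintegral (@leb R n) (@Rplusn R n) b.
Proof.
have mP := measurable_Rplus; have mPn := @measurable_Rplusn n.
have mPn1 := @measurable_Rplusn n.+1.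
move=> /(integrable_mkcond _ mP); rewrite restrict_EFin => ia.
move=> /(integrable_mkcond _ mPn); rewrite restrict_EFin => ib.
have [iab eab] := integrable_prodM ia ib.
pose f (t : n.+1.-tuple mR) :=
  ((a \_ (@Rplus R)) (thead t) * (b \_ (@Rplusn R n)) [tuple of behead t])%:E.
have mf : measurable_fun setT f.
  apply/measurable_EFinP; apply: measurable_funM.
    move: ia => /(measurable_int _)/measurable_EFinP ma.
    exact: measurableT_comp ma (@measurable_thead n).
  move: ib => /(measurable_int _)/measurable_EFinP mb.
  exact: measurableT_comp mb (@measurable_behead _ mR n).
have fE : f \o @tcons R n = fun p => ((a \_ (@Rplus R)) p.1 * (b \_ (@Rplusn R n)) p.2)%:E.
  apply/funext => -[x t]; rewrite /f /comp.
  have -> : thead (@tcons R n (x, t)) = x by rewrite theadE.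
  have -> // : [tuple of behead (@tcons R n (x, t))] = t by exact: val_inj.
have fD t : Rplusn t -> f t = (a (thead t) * b [tuple of behead t])%:E.
  move=> t0; rewrite /f !patchE !mem_set//; first exact: Rplusn_behead.
  exact: Rplusn_thead.
have mphi := @measurable_tcons R n.
have iD : (@lebesgue_measure R \x @leb R n)%E.-integrable
    (@tcons R n @^-1` (@Rplusn R n.+1)) (f \o @tcons R n).
  rewrite fE tcons_preimage_Rplusn; apply: (integrableS _ _ _ iab) => //.
  exact: measurableX.
have fi : (@leb R n.+1).-integrable (@Rplusn R n.+1) f.
  exact: integrable_pushforward.
have ff : {in @Rplusn R n.+1, f =1 (fun t => (a (thead t) * b [tuple of behead t])%:E)}.
  by move=> t /set_mem; exact: fD.
split; first exact: eq_integrable fi.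
rewrite /Rintegral -(eq_integral _ _ (fun t tD => ff t tD)).
rewrite (_ : integral _ _ f = \int[(@lebesgue_measure R \x @leb R n)%E]_p
    (f \o @tcons R n) p)%E; last first.
  rewrite (integral_pushforward mphi mf iD mPn1) integral_mkcond.
  apply: eq_integral => p _; rewrite patchE; case: ifPn => // /negP pD.
  rewrite fE !patchE; case: ifPn => [/set_mem p1|_]; last by rewrite mul0r.
  case: ifPn => [/set_mem p2|_]; last by rewrite mulr0.
  by exfalso; apply: pD; apply/mem_set; rewrite tcons_preimage_Rplusn.
rewrite fE eab (integral_mkcond (@Rplus R)) (integral_mkcond (@Rplusn R n)).
rewrite !restrict_EFin fineM//; exact: integrable_fin_num.
Qed.

End lebesgue_tuple_facts.

(** * Creation and annihilation operators *)

Section tensor_kernels.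
Variable R : realType.
Local Notation mR := (measurableTypeR R).

Definition L2Rdot (h k : L2R R) : R :=
  Rintegral (@lebesgue_measure R) (@Rplus R) (fun t => h t * k t).

Lemma L2R_measurable (h : L2R R) : measurable_fun (@Rplus R) h.
Proof. by have [] := L2R_prop h. Qed.

Lemma L2RM_integrable (h k : L2R R) :
  (@lebesgue_measure R).-integrable (@Rplus R) (EFin \o (fun t => h t * k t)).
Proof.
have [+ _] := sqintM_integrable (@measurable_Rplus R) (L2R_prop h) (L2R_prop k).
by apply: eq_integrable => [|t _ /=]; [exact: measurable_Rplus|rewrite oppr0 mulr0 subr0].
Qed.

Lemma L2n_tens n (h : L2R R) (g : n.-tuple mR -> R[i]) : L2n g ->
  L2n (tens (fun t => (h t)%:C%C) g).
Proof.
move=> sg; have [gRe gIm _] := sg.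
have mh := @measurable_fun_thead R n _ (@L2R_measurable h).
split.
- under eq_fun do rewrite /tens ReM /= mul0r subr0.
  by apply: measurable_funM => //; exact: measurable_fun_behead gRe.
- under eq_fun do rewrite /tens ImM /= mul0r addr0.
  by apply: measurable_funM => //; exact: measurable_fun_behead gIm.
have [+ _] := integrable_tens (L2RM_integrable h h) (sqint_integrable sg).
move=> /(integrable_lty (@measurable_Rplusn R n.+1)); congr (_ < _)%E.
apply: eq_integral => t _; congr EFin.
by rewrite /tens sqnormcM /sqnormc /= expr0n addr0 expr2.
Qed.

Lemma L2ndot_tens n (h k : L2R R) (f g : n.-tuple mR -> R[i]) : L2n f -> L2n g ->
  L2ndot (tens (fun t => (h t)%:C%C) f) (tens (fun t => (k t)%:C%C) g) =
  (L2Rdot h k)%:C%C * L2ndot f g.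
Proof.
move=> sf sg.
have [iRe iIm] := sqintM_integrable (@measurable_Rplusn R n) sf sg.
have ihk := L2RM_integrable h k.
have [_ eRe] := integrable_tens ihk iRe; have [_ eIm] := integrable_tens ihk iIm.
have E t : tens (fun t => (h t)%:C%C) f t * Num.conj (tens (fun t => (k t)%:C%C) g t) =
    (h (thead t) * k (thead t))%:C%C *
    (f [tuple of behead t] * Num.conj (g [tuple of behead t])).
  rewrite /tens; move: (h _) (k _) (f _) (g _) => a b [c d] [e e'].
  by apply/eqP; rewrite eq_complex /=; apply/andP; split; apply/eqP; ring.
rewrite /L2ndot /L2dot /cintegral.
under eq_Rintegral do rewrite E ReM /= mul0r subr0.
under [X in (_ +i* X)%C]eq_Rintegral do rewrite E ImM /= mul0r addr0.
rewrite eRe eIm /L2Rdot; apply/eqP; rewrite eq_complex /=.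
by rewrite !mul0r subr0 addr0 !eqxx.
Qed.

End tensor_kernels.

Section fock_facts.
Variables (R : realType) (Fk : fock R).
Local Notation mR := (measurableTypeR R).
Local Notation word := (seq (L2R R)).
Local Notation cre h := (@creation R Fk (fun t => (h t)%:C%C)).
Local Notation ann h := (@annihilation R Fk (fun t => (h t)%:C%C)).
Implicit Types (h k : L2R R) (x y : Fk).

(** [x] is the limit of finite sums S_N of chaoses, all orthogonal to it, so |x|^2 = <x, x - S_N> <=
    |x| |x - S_N|. This is how vectors given only through inner products are identified. *)
Lemma chaos_total x :
  (forall n (g : n.-tuple mR -> R[i]), L2n g -> hip x (chaos Fk g) = 0) -> x = 0.
Proof.
move=> xg; have [f [fL fx]] := chaos_sum x.
have xS N : hip x (\sum_(k < N) chaos Fk (f k)) = 0.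
  by rewrite hipC hip_suml big1 ?conjC0// => i _; rewrite hipC xg// conjC0.
have le N : hnorm x <= hnorm ((\sum_(k < N) chaos Fk (f k)) - x).
  rewrite hnormB.
  have := Re_hip_le x (x - \sum_(k < N) chaos Fk (f k)).
  rewrite hipBr xS subr0 -hnorm2E -sqr_hnorm expr2.
  have [->|x0] := eqVneq (hnorm x) 0; first by rewrite hnorm_ge0.
  by rewrite ler_pM2l// lt_neqAle eq_sym x0 hnorm_ge0.
apply: hnorm_eq0; apply/eqP; rewrite eq_le hnorm_ge0 andbT.
by apply: (cvgr_to_ge fx); exact: nearW.
Qed.

Lemma creationE_L2R h n (g : n.-tuple mR -> R[i]) : L2n g ->
  cre h (chaos Fk g) = chaos Fk (tens (fun t => (h t)%:C%C) g).
Proof. by move=> gL; rewrite creationE//; exact: L2R_prop. Qed.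

Lemma cre_linear h : linear (cre h).
Proof. by have [] := creation_bounded Fk (L2R_prop h). Qed.

Lemma ann_linear h : linear (ann h).
Proof. by have [] := annihilation_bounded Fk (L2R_prop h). Qed.

Lemma hip_ann h x y : hip (ann h x) y = hip x (cre h y).
Proof. by rewrite hipC [RHS]hipC; congr Num.conj; rewrite /hip annihilationE//; exact: L2R_prop. Qed.

Lemma hip_cre h x y : hip (cre h x) y = hip x (ann h y).
Proof. by rewrite /hip annihilationE//; exact: L2R_prop. Qed.

Lemma hip_chaos n (f g : n.-tuple mR -> R[i]) : L2n f -> L2n g ->
  hip (chaos Fk f) (chaos Fk g) = L2ndot f g.
Proof. exact: chaos_isometry. Qed.

Lemma hip_chaos_neq m n (f : m.-tuple mR -> R[i]) (g : n.-tuple mR -> R[i]) :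
  L2n f -> L2n g -> m <> n -> hip (chaos Fk f) (chaos Fk g) = 0.
Proof. exact: chaos_orthogonal. Qed.

(** Annihilation is specified as the adjoint of creation, so the relation is tested against every
    chaos: in equal degrees the inner product of tensors factors, in different degrees both sides
    vanish. *)
Lemma ann_cre_chaos h k n (f : n.-tuple mR -> R[i]) : L2n f ->
  ann h (cre k (chaos Fk f)) = (L2Rdot k h)%:C%C *: chaos Fk f.
Proof.
move=> fL; apply/eqP; rewrite -subr_eq0; apply/eqP/chaos_total => m g gL.
rewrite hipBl hip_ann hipZl !creationE_L2R//.
have [mn|nm] := pselect (n = m).
  by subst m; rewrite !hip_chaos ?L2ndot_tens ?subrr//; exact: L2n_tens.
by rewrite !hip_chaos_neq ?mulr0 ?subr0//; [exact: L2n_tens..|move=> []].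
Qed.

Lemma leb0_Rplusn : @leb R 0 (@Rplusn R 0) = 1%E.
Proof.
rewrite -[LHS]/(dirac ([tuple] : 0.-tuple mR) (@Rplusn R 0)) /dirac indicE.
by rewrite mem_set// => -[].
Qed.

Lemma L2n_vacuum : L2n (fun _ : 0.-tuple mR => 1 : R[i]).
Proof.
split; [exact: measurable_cst|exact: measurable_cst|].
rewrite /sqnormc /= expr1n expr0n addr0 integral_cst; last exact: measurable_Rplusn.
rewrite mul1e; set z := (X in (X < _)%E); have -> : z = 1%E by exact: leb0_Rplusn. exact: ltry.
Qed.

Lemma hnorm2_vacuum : hnorm2 (vacuum Fk) = 1.
Proof.
apply: (@complexI R); rewrite -hipxx hip_chaos; [|exact: L2n_vacuum..].
rewrite /L2ndot L2dotxx; last exact: L2n_vacuum.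
congr (_%:C)%C; rewrite /Rintegral /sqnormc /= expr1n expr0n addr0.
rewrite integral_cst; last exact: measurable_Rplusn.
by rewrite mul1e; set z := fine _; have -> : z = fine 1 by congr fine; exact: leb0_Rplusn.
Qed.

Lemma ann_vacuum h : ann h (vacuum Fk) = 0.
Proof.
apply: chaos_total => n g gL; rewrite hip_ann creationE_L2R// hip_chaos_neq//.
- exact: L2n_vacuum.
- exact: L2n_tens.
Qed.

Lemma chaos0 n : chaos Fk (fun _ : n.-tuple mR => 0) = 0.
Proof.
have L0 : L2n (fun _ : n.-tuple mR => 0 : R[i]).
  exact: sqint0.
have := chaos_linear Fk (-1) L0 L0.
by under eq_fun do rewrite mulr0 addr0; rewrite scaleN1r addNr.
Qed.

Lemma chaos_sum_lin n I (r : seq I) (c : I -> R[i]) (F : I -> n.-tuple mR -> R[i]) :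
  (forall i, L2n (F i)) ->
  chaos Fk (fun t => \sum_(i <- r) c i * F i t) = \sum_(i <- r) c i *: chaos Fk (F i).
Proof.
move=> FL; elim: r => [|i r IH].
  by under eq_fun do rewrite big_nil; rewrite big_nil chaos0.
under eq_fun do rewrite big_cons; rewrite big_cons -IH chaos_linear//.
by apply: sqint_sum => //; exact: measurable_Rplusn.
Qed.

End fock_facts.

(** * Chaos components of words *)

Section monomials.
Variable R : realType.
Local Notation word := (seq (L2R R)).

(** This turns [ext] into an explicit finite sum over words, the form to which [sqint_sum] and
    [chaos_sum_lin] apply. *)
Fixpoint monomials (P : scalg R) : seq (R[i] * word) :=
  match P with
  | SCconst c => [:: (c, [::])]
  | SCgen h => [:: (1, [:: h])]
  | SCadd A B => monomials A ++ monomials B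
  | SCmul A B => [seq (a.1 * b.1, a.2 ++ b.2) | a <- monomials A, b <- monomials B]
  end.

Lemma ext_monomials (V : lmodType R[i]) P (phi : word -> V) :
  ext P phi = \sum_(m <- monomials P) m.1 *: phi m.2.
Proof.
elim: P phi => [c|h|A IHA B IHB|A IHA B IHB] phi /=.
- by rewrite big_seq1.
- by rewrite big_seq1 scale1r.
- by rewrite big_cat IHA IHB.
rewrite big_allpairs_dep IHA /=; apply: eq_bigr => a _.
by rewrite IHB scaler_sumr; apply: eq_bigr => b _; rewrite scalerA.
Qed.

(** Both sides run over the factorizations w = u1 k u2 h u3; the outer sum selects k on the left and
    h on the right. *)
Lemma splits_coassoc (V : nmodType) (F : word -> L2R R -> word -> L2R R -> word -> V) w :
  \sum_(s <- splits w) \sum_(r <- splits s.2) F s.1.1 s.1.2 r.1.1 r.1.2 r.2 =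
  \sum_(s <- splits w) \sum_(r <- splits s.1.1) F r.1.1 r.1.2 r.2 s.1.2 s.2.
Proof.
elim: w F => [|h w IH] F /=; first by rewrite !big_nil.
rewrite !big_cons big_nil add0r !big_map /=.
rewrite (IH (fun u => F (h :: u))) -big_split /=; apply: eq_bigr => s _.
by rewrite big_cons big_map.
Qed.

Lemma size_splits (w : word) s : List.In s (splits w) ->
  (size s.1.1 < size w)%N /\ (size s.2 < size w)%N.
Proof.
elim: w s => [|h w IH] s //= [<-//|/List.in_map_iff[r [<- rw]] /=].
by have [? ?] := IH r rw; split; rewrite ltnS// ltnW.
Qed.

Lemma eq_big_splits (V : nmodType) (w : word) (F G : word * L2R R * word -> V) :
  (forall s, (size s.1.1 < size w)%N -> (size s.2 < size w)%N -> F s = G s) ->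
  \sum_(s <- splits w) F s = \sum_(s <- splits w) G s.
Proof.
by move=> FG; apply: eq_big_In => s /size_splits[? ?]; exact: FG.
Qed.

End monomials.

Section word_chaos.
Variables (R : realType) (Fk : fock R).
Local Notation mR := (measurableTypeR R).
Local Notation word := (seq (L2R R)).
Local Notation cre h := (@creation R Fk (fun t => (h t)%:C%C)).
Local Notation ann h := (@annihilation R Fk (fun t => (h t)%:C%C)).
Local Notation Omega := (vacuum Fk).
Local Notation trw w := (tau (@wop R Fk w)).
Implicit Types (h : L2R R) (w : word).

(* The [n]-th chaos component of [wop w Omega], see [wop_vacuum]. *)
Fixpoint wchaos n (w : word) : Fk :=
  match n with
  | 0%N => trw w *: Omega
  | m.+1 => \sum_(s <- splits w) trw s.1.1 *: cre s.1.2 (wchaos m s.2)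
  end.

Lemma wchaos0 w : wchaos 0 w = trw w *: Omega.
Proof. by []. Qed.

Lemma wchaosS n w : wchaos n.+1 w =
  \sum_(s <- splits w) trw s.1.1 *: cre s.1.2 (wchaos n s.2).
Proof. by []. Qed.

Arguments wchaos : simpl never.

Definition wkernel n (w : word) (t : n.-tuple mR) : R[i] :=
  wnabla t (fun ws => \prod_(u <- ws) trw u : R[i]^o) w.

Lemma wkernelS n w (t : n.+1.-tuple mR) : wkernel w t =
  \sum_(s <- splits w) trw s.1.1 *
    tens (fun t => (s.1.2 t)%:C%C) (@wkernel n s.2) t.
Proof.
rewrite /wkernel (tuple_eta_cons t) /=; apply: eq_bigr => s _.
rewrite /tens mulrCA; congr (_ * _).
have L : linear (fun z : R[i]^o => trw s.1.1 * z : R[i]^o).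
  by move=> a x y; rewrite mulrDr mulrCA.
rewrite (wnabla_morph _ _ _ L); congr wnabla; apply/funext => l.
by rewrite /= big_cons.
Qed.

(** Kernel and vector obey the same recursion: the first derivative detaches a prefix, whose trace
    is a scalar, and a letter evaluated at the first variable, which is what creation tensors in
    front. *)
Lemma chaos_wkernel n w :
  L2n (@wkernel n w) /\ chaos Fk (@wkernel n w) = wchaos n w.
Proof.
elim: n w => [|n IH] w.
  (* The constant is written as a sum over one index, so that the lemmas on linear combinations
     cover degree zero. *)
  have E : (@wkernel 0 w) = fun _ => \sum_(i <- [:: tt]) trw w * 1.
    apply/funext => t; rewrite /wkernel tuple0 /= !big_seq1.
    by rewrite mulr1.
  split; rewrite E.
    by apply: sqint_sum => [|_]; [exact: measurable_Rplusn|exact: L2n_vacuum].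
  by rewrite (@chaos_sum_lin R Fk 0 _ [:: tt] (fun=> trw w) (fun _ _ => 1) (fun=> @L2n_vacuum R)) big_seq1.
have E : (@wkernel n.+1 w) = fun t => \sum_(s <- splits w) trw s.1.1 *
    tens (fun t => (s.1.2 t)%:C%C) (@wkernel n s.2) t.
  by apply/funext => t; rewrite wkernelS.
have tL (s : word * L2R R * word) : L2n (tens (fun t => (s.1.2 t)%:C%C) (@wkernel n s.2)).
  by apply: L2n_tens; have [] := IH s.2.
split; rewrite E.
  by apply: sqint_sum => //; exact: measurable_Rplusn.
rewrite chaos_sum_lin// wchaosS; apply: eq_bigr => s _; have [sL <-] := IH s.2.
by rewrite creationE_L2R.
Qed.

Lemma ann_wchaos0 h w : ann h (wchaos 0 w) = 0.
Proof.
have [_ _ aZ] := linear_morphs (@ann_linear R Fk h).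
by rewrite wchaos0 aZ ann_vacuum scaler0.
Qed.

Lemma linear_big_sum (V W : lmodType R[i]) (f : V -> W) I (r : seq I) (F : I -> V) :
  linear f -> f (\sum_(i <- r) F i) = \sum_(i <- r) f (F i).
Proof.
move=> /linear_morphs[f0 fD _]; elim: r => [|i r IH]; first by rewrite !big_nil.
by rewrite !big_cons fD IH.
Qed.

Lemma ann_wchaosS h n w : ann h (wchaos n.+1 w) =
  \sum_(s <- splits w) (trw s.1.1 * (L2Rdot s.1.2 h)%:C%C) *: wchaos n s.2.
Proof.
have [_ _ aZ] := linear_morphs (@ann_linear R Fk h).
rewrite wchaosS linear_big_sum; last exact: ann_linear.
apply: eq_bigr => s _; rewrite aZ; have [sL <-] := chaos_wkernel n s.2.
by rewrite ann_cre_chaos// scalerA.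
Qed.

Lemma hip_wchaosS_vacuum n w : hip (wchaos n.+1 w) Omega = 0.
Proof.
rewrite wchaosS hip_suml big1// => s _.
by rewrite hipZl hip_cre ann_vacuum hip0r mulr0.
Qed.

Lemma trw_nil : trw [::] = 1.
Proof. by rewrite /tau /= -/(hip _ _) hipxx hnorm2_vacuum. Qed.

(* The Schwinger-Dyson equation. *)
Lemma trw_cons h w :
  (forall M, (size w < M)%N -> wop w Omega = \sum_(n < M) wchaos n w) ->
  trw (h :: w) = \sum_(s <- splits w)
    trw s.1.1 * (L2Rdot s.1.2 h)%:C%C * trw s.2.
Proof.
(* With this bound the terms of degree zero and one exist even for the empty word. After
   annihilation, degree zero vanishes, degree one gives a multiple of the vacuum, and higher degrees
   are orthogonal to it. *)
move=> /(_ (size w).+2 (ltnW (ltnSn _))) wE.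
rewrite /tau -/(hip _ _) /= /Sop hipDl hip_cre ann_vacuum hip0r add0r wE.
rewrite linear_big_sum; last exact: ann_linear.
rewrite hip_suml 2!big_ord_recl /= ann_wchaos0 hip0l add0r.
rewrite big1 ?addr0; last first.
  move=> i _; rewrite /bump /= ann_wchaosS hip_suml big1// => s _.
  by rewrite hipZl hip_wchaosS_vacuum mulr0.
rewrite /bump /= ann_wchaosS hip_suml; apply: eq_bigr => s _.
by rewrite hipZl wchaos0 hipZl hipxx hnorm2_vacuum mulr1.
Qed.

(** S(h) raises or lowers the degree by one. In degree i + 1 of h w, creation contributes the split
    with empty prefix and annihilation all the others; in degree zero, annihilation of v_1(w) gives
    tau(h w). The bound [M] is arbitrary so that the induction hypothesis can be used at several
    cutoffs. *)
Lemma wop_vacuum w M : (size w < M)%N ->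
  wop w Omega = \sum_(n < M) wchaos n w.
Proof.
have [m] := ubnP (size w); elim: m w M => // m IH [|h w] M /=.
  move=> _; case: M => // M _; rewrite big_ord_recl /= wchaos0 trw_nil scale1r.
  by rewrite big1 ?addr0// => i _; rewrite /bump /= wchaosS big_nil.
rewrite ltnS => wm; case: M => // K; rewrite ltnS => wK.
rewrite /Sop big_ord_recl /= wchaos0.
(* Cutoff K under creation and K + 2 under annihilation: once the two lowest terms of the latter are
   split off, both sums have the same indices. *)
rewrite {1}(IH w K)// (IH w K.+2 wm (leqW (leqW wK))).
rewrite (linear_big_sum _ _ (@cre_linear R Fk h)) (linear_big_sum _ _ (@ann_linear R Fk h)).
rewrite 2!big_ord_recl /bump /= ann_wchaos0 add0r.
rewrite (_ : ann h (wchaos 1 w) = trw (h :: w) *: Omega); last first.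
  rewrite ann_wchaosS trw_cons; last by move=> M; exact: IH.
  rewrite scaler_suml; apply: eq_bigr => s _ /=.
  by rewrite wchaos0 scalerA.
rewrite addrCA; congr (_ + _); rewrite -big_split; apply: eq_bigr => i _ /=.
rewrite [wchaos _ (h :: w)]wchaosS big_cons big_map /= trw_nil scale1r; congr (_ + _).
rewrite ann_wchaosS.
(* Here [k] is the letter contracted with [h], and [h'] is the first letter that survives. *)
pose F u1 k u2 h' u3 : Fk :=
  (trw u1 * (L2Rdot k h)%:C%C * trw u2) *: cre h' (wchaos i u3).
transitivity (\sum_(s <- splits w) \sum_(r <- splits s.2)
    F s.1.1 s.1.2 r.1.1 r.1.2 r.2).
  apply: eq_bigr => s _; rewrite wchaosS scaler_sumr; apply: eq_bigr => r _.
  by rewrite scalerA.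
(* With [h'] chosen first, the inner sum over the prefix u1 k u2 is the Schwinger-Dyson equation for
   [h] followed by that prefix, which is shorter than [w]. *)
rewrite splits_coassoc; apply: eq_big_splits => s sw _.
rewrite trw_cons; first by rewrite scaler_suml.
by move=> M; apply: IH; exact: ltn_trans sw wm.
Qed.

Lemma hip_wop_chaos w n (g : n.-tuple mR -> R[i]) : L2n g ->
  hip (wop w Omega) (chaos Fk g) = hip (chaos Fk (@wkernel n w)) (chaos Fk g).
Proof.
(* The cutoff also exceeds [n], so that the term of degree [n] is present even when [w] is shorter
   than [n]. *)
move=> gL; rewrite (@wop_vacuum w (maxn (size w) n).+1) ?ltnS ?leq_maxl//.
have nM : (n < (maxn (size w) n).+1)%N by rewrite ltnS leq_maxr.
rewrite hip_suml (bigD1 (Ordinal nM))//= big1 ?addr0; last first.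
  move=> j jn; have [jL <-] := chaos_wkernel j w; apply: hip_chaos_neq => // jn'.
  by move/eqP: jn; apply; exact: val_inj.
by have [_ ->] := chaos_wkernel n w.
Qed.

End word_chaos.

(** * The derivative on SC_alg and its trace *)

Section nabla_words.
Variables (R : realType) (Fk : fock R) (L2 : forall k, L2SC Fk k).
Local Notation mR := (measurableTypeR R).
Local Notation word := (seq (L2R R)).
Local Notation Omega := (vacuum Fk).

(** Each derivative adds exactly one factor, so [Lam_sceval] applies and [tensval] never reads a
    default. *)
Lemma size_itgrad (ts : seq R) (P : scalg R) px :
  List.In px (itgrad ts P) -> size px.1 = size ts.
Proof.
suff gen k T : (forall qx, List.In qx T -> size qx.1 = k) ->
    List.In px (foldl (fun T t => flatten [seq grad_last t px | px <- T]) T ts) ->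
    size px.1 = (k + size ts)%N.
  by move=> /(gen 0%N); rewrite add0n; apply => qx [<-|].
elim: ts k T => [|t ts IH] k T Tk /=; first by rewrite addn0; exact: Tk.
rewrite addnS -addSn; apply: IH => qx.
elim: T Tk => [|rx T IHT] //= Tk qxT; have [|] := In_cat qxT; last first.
  by apply: IHT => r ?; apply: Tk; right.
by move=> /List.in_map_iff[uv [<- _]] /=; rewrite size_rcons Tk//; left.
Qed.

Definition Lamw n (ws : seq word) : L2 n := Lam (L2 n) (fun i => wop (nth [::] ws i)).

Lemma nabla_algE n P (t : n.-tuple mR) :
  nabla_alg L2 P t = ext P (wnabla t (@Lamw n)).
Proof.
rewrite /nabla_alg (eq_big_In (G := fun px => extl (rcons px.1 px.2) (@Lamw n))).
  by rewrite extl_itgrad big_seq1.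
move=> px /size_itgrad spx; rewrite /tensval Lam_sceval//.
by rewrite size_rcons spx size_tuple.
Qed.

Lemma nabla_algB n P Q (t : n.-tuple mR) :
  nabla_alg L2 (SCsub P Q) t = nabla_alg L2 P t - nabla_alg L2 Q t.
Proof. by rewrite !nabla_algE /= scaleN1r. Qed.

(** The trace of [Lamw] is a product of traces only for tensors of exactly n + 1 words; these are
    the only ones at which [wnabla] evaluates [Th]. *)
Lemma eq_wnabla (V : lmodType R[i]) (ts : seq R) (Th Th' : seq word -> V) w :
  (forall ws, size ws = (size ts).+1 -> Th ws = Th' ws) ->
  wnabla ts Th w = wnabla ts Th' w.
Proof.
elim: ts Th Th' w => [|t ts IH] Th Th' w TT /=; first exact: TT.
apply: eq_bigr => s _; congr (_ *: _); apply: IH => ws sws.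
by apply: TT; rewrite /= sws.
Qed.

Lemma tautens_linear n : linear (@tautens R Fk n (L2 n) : L2 n -> R[i]^o).
Proof. by move=> a x y; rewrite /tautens -!/(hip _ _) hipDl hipZl. Qed.

Lemma adjoint_id : adjoint (id : Fk -> Fk) id.
Proof. by []. Qed.

Lemma tautens_Lamw n ws : size ws = n.+1 ->
  tautens (@Lamw n ws) = \prod_(u <- ws) tau (@wop R Fk u).
Proof.
move=> sws; rewrite /tautens.
rewrite (@Lam_dot _ _ _ (L2 n) _ _ (fun=> id)).
- by rewrite (big_nth [::]) sws big_mkord.
- by move=> j; exact: SC_wop.
- by move=> j; exact: SC_id.
- by move=> j; split; [exact: bounded_op_id|exact: adjoint_id].
Qed.

Lemma hnorm2_Lam_id n : hnorm2 (Lam (L2 n) (fun=> id)) = 1.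
Proof.
apply: (@complexI R); rewrite -hipxx /hip (@Lam_dot _ _ _ (L2 n) _ _ (fun=> id)).
- by rewrite big1// => i _; rewrite -(@trw_nil R Fk).
- by move=> j; exact: SC_id.
- by move=> j; exact: SC_id.
- by move=> j; split; [exact: bounded_op_id|exact: adjoint_id].
Qed.

Lemma sqnormc_tautens n (x : L2 n) : sqnormc (tautens x) <= hnorm2 x.
Proof. by rewrite (le_trans (sqnormc_hip_le _ _))// hnorm2_Lam_id mulr1. Qed.

Lemma tautens_nabla n P (t : n.-tuple mR) : tautens (nabla_alg L2 P t) =
  \sum_(m <- monomials P) m.1 * wkernel Fk m.2 t.
Proof.
rewrite nabla_algE (ext_morph P _ (@tautens_linear n)) ext_monomials.
apply: eq_bigr => m _; congr (_ * _); rewrite /wkernel /=.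
rewrite (wnabla_morph _ _ _ (@tautens_linear n)); apply: eq_wnabla => ws.
by rewrite size_tuple => /tautens_Lamw.
Qed.

Lemma L2n_tautens_nabla n P :
  L2n (fun t : n.-tuple mR => tautens (nabla_alg L2 P t)).
Proof.
under eq_fun do rewrite tautens_nabla.
apply: sqint_sum => [|m]; first exact: measurable_Rplusn.
by have [] := chaos_wkernel Fk n m.2.
Qed.

(* Stroock's formula on SC_alg. *)
Lemma hip_sceval_chaos n P (g : n.-tuple mR -> R[i]) : L2n g ->
  hip (sceval P Omega) (chaos Fk g) =
  hip (chaos Fk (fun t : n.-tuple mR => tautens (nabla_alg L2 P t))) (chaos Fk g).
Proof.
move=> gL; rewrite sceval_ext ext_monomials.
under [in RHS]eq_fun do rewrite tautens_nabla.
rewrite chaos_sum_lin; last by move=> m; have [] := chaos_wkernel Fk n m.2.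
rewrite !hip_suml; apply: eq_bigr => m _.
by rewrite !hipZl hip_wop_chaos.
Qed.

(** Finite sums of scalar square-integrable kernels times fixed vectors. Derivatives of expressions
    have this form, which gives their measurability and square integrability by way of the scalar
    case. *)
Definition L2comb (V : lmodType R[i]) n (G : n.-tuple mR -> V) : Prop :=
  exists l : seq ((n.-tuple mR -> R[i]) * V),
    (forall cv, List.In cv l -> L2n cv.1) /\
    forall t, G t = \sum_(cv <- l) cv.1 t *: cv.2.

Lemma L2comb_sum (V : lmodType R[i]) n I (r : seq I) (G : I -> n.-tuple mR -> V) :
  (forall i, L2comb (G i)) -> L2comb (fun t => \sum_(i <- r) G i t).
Proof.
move=> GL; elim: r => [|i r [l [lL lE]]].
  by exists [::]; split => // t; rewrite !big_nil.
have [k [kL kE]] := GL i; exists (k ++ l); split.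
  by move=> cv cvkl; have [/kL|/lL] := In_cat cvkl.
by move=> t; rewrite big_cons big_cat kE lE.
Qed.

Lemma L2combZ (V : lmodType R[i]) n a (G : n.-tuple mR -> V) :
  L2comb G -> L2comb (fun t => a *: G t).
Proof.
move=> [l [lL lE]]; exists [seq (cv.1, a *: cv.2) | cv <- l]; split.
  by move=> _ /List.in_map_iff[cv [<- /lL]].
move=> t; rewrite lE big_map scaler_sumr; apply: eq_bigr => cv _ /=.
by rewrite !scalerA mulrC.
Qed.

Lemma L2comb_wnabla (V : lmodType R[i]) n (Th : seq word -> V) w :
  L2comb (fun t : n.-tuple mR => wnabla t Th w).
Proof.
elim: n Th w => [|n IH] Th w.
  exists [:: (fun=> 1, Th [:: w])]; split => [cv [<-|//]|t].
    exact: L2n_vacuum.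
  by rewrite tuple0 big_seq1 scale1r.
have -> : (fun t : n.+1.-tuple mR => wnabla t Th w) = (fun t => \sum_(s <- splits w)
    (s.1.2 (thead t))%:C%C *: wnabla [tuple of behead t] (fun l => Th (s.1.1 :: l)) s.2).
  by apply/funext => t; rewrite {1}(tuple_eta_cons t).
apply: L2comb_sum => s; have [l [lL lE]] := IH (fun l => Th (s.1.1 :: l)) s.2.
exists [seq (tens (fun t => (s.1.2 t)%:C%C) cv.1, cv.2) | cv <- l]; split.
  by move=> _ /List.in_map_iff[cv [<- /lL]]; exact: L2n_tens.
move=> t; rewrite lE big_map scaler_sumr; apply: eq_bigr => cv _.
by rewrite scalerA.
Qed.

Lemma L2comb_nabla n P : L2comb (fun t : n.-tuple mR => nabla_alg L2 P t).
Proof.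
rewrite (_ : (fun t => _) = fun t : n.-tuple mR =>
    \sum_(m <- monomials P) m.1 *: wnabla t (@Lamw n) m.2); last first.
  by apply/funext => t; rewrite nabla_algE ext_monomials.
by apply: L2comb_sum => m; apply: L2combZ; exact: L2comb_wnabla.
Qed.

End nabla_words.

(** * Square-integrable functions with values in a Hilbert space *)

Section bochner_square_integrable.
Import HBNNSimple.
Context (R : realType) d (T : measurableType d) (mu : {measure set T -> \bar R}).
Variables (D : set T) (mD : measurable D) (H : hilbert R).
Implicit Types F G : T -> H.

Lemma hcvg_hnorm2 (u : nat -> H) (l : H) : hcvg u l ->
  hnorm2 (u n) @[n --> \oo] --> hnorm2 l.
Proof.
move=> ul.
have ul' : hnorm (u n) @[n --> \oo] --> hnorm l.
  have tri (x y : H) : hnorm x - hnorm (x - y) <= hnorm y /\ hnorm y <= hnorm x + hnorm (x - y).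
    split; first by rewrite lerBlDr addrC -{1}(subrK y x) hnormD_le.
    by rewrite hnormB addrC -{1}(subrK x y) hnormD_le.
  apply: (@squeeze_cvgr _ _ _ _ (fun n => hnorm l - hnorm (u n - l))
    (fun n => hnorm l + hnorm (u n - l))).
  - near=> n; rewrite hnormB; have [-> ->] := tri l (u n); by [].
  - by rewrite -[X in _ --> X]subr0; apply: cvgB => //; exact: cvg_cst.
  - by rewrite -[X in _ --> X]addr0; apply: cvgD => //; exact: cvg_cst.
under eq_fun do rewrite -sqr_hnorm expr2.
by rewrite -sqr_hnorm expr2; exact: cvgM.
Unshelve. all: by end_near. Qed.

Lemma simple_HfunD F G : simple_Hfun F -> simple_Hfun G ->
  simple_Hfun (fun t => F t + G t).
Proof.
move=> [M [A [v [mA FE]]]] [N [B [w [mB GE]]]].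
exists (M + N)%N, (fun i => match fintype.split i with inl j => A j | inr j => B j end),
  (fun i => match fintype.split i with inl j => v j | inr j => w j end); split.
  by move=> i; case: fintype.split.
move=> t; rewrite big_split_ord FE GE; congr (_ + _); apply: eq_bigr => i _ /=.
  by rewrite -[lshift N i]/(unsplit (inl i)) unsplitK.
by rewrite -[rshift M i]/(unsplit (inr i)) unsplitK.
Qed.

Lemma simple_HfunZ (a : R[i]) F : simple_Hfun F -> simple_Hfun (fun t => a *: F t).
Proof.
move=> [N [A [v [mA FE]]]]; exists N, A, (fun i => a *: v i); split => // t.
rewrite FE scaler_sumr; apply: eq_bigr => i _; by rewrite !scalerA mulrC.
Qed.

Lemma simple_Hfun_restrict E F : measurable E -> simple_Hfun F ->
  simple_Hfun (fun t => (\1_E t : R)%:C%C *: F t).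
Proof.
move=> mE [N [A [v [mA FE]]]]; exists N, (fun i => A i `&` E), v; split.
  by move=> i; exact: measurableI.
move=> t; rewrite FE scaler_sumr; apply: eq_bigr => i _.
by rewrite scalerA indicI /= rmorphM mulrC.
Qed.

Lemma simple_Hfun_nnsfun (s : {nnsfun T >-> R}) (v : H) :
  simple_Hfun (fun t => (s t)%:C%C *: v).
Proof.
pose r : seq R := finmap.enum_fset (fset_set (range s)).
exists (size r), (fun i => s @^-1` [set r`_i]), (fun i => (r`_i)%:C%C *: v); split.
  by move=> i; exact: measurable_sfunP.
move=> t; rewrite {1}(fimfunEord s t) rmorph_sum scaler_suml.
by apply: eq_bigr => i _; rewrite rmorphM scalerA mulrC.
Qed.

Lemma simple_Hfun_cst (v : H) : simple_Hfun (fun _ : T => v).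
Proof.
exists 1%N, (fun=> setT), (fun=> v); split => // t.
by rewrite big_ord1 indicT scale1r.
Qed.

Lemma measurable_simple_hip F (G : T -> H) :
  simple_Hfun F -> (forall v, measurable_fun D (fun t => complex.Re (hip v (G t)))) ->
  measurable_fun D (fun t => complex.Re (hip (F t) (G t))).
Proof.
move=> [N [A [v [mA FE]]]] mG.
have -> : (fun t => complex.Re (hip (F t) (G t))) =
    (fun t => \sum_(i < N) \1_(A i) t * complex.Re (hip (v i) (G t))).
  apply/funext => t; rewrite FE hip_suml.
  elim/big_rec2: _ => // i x y _ <-; rewrite ReD hipZl ReM /=.
  by rewrite mul0r subr0.
apply: measurable_sum => i; apply: measurable_funM; last exact: mG.
by apply: measurable_funTS; exact: measurable_indic.
Qed.

Lemma measurable_simple_hnorm2 F : simple_Hfun F ->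
  measurable_fun D (fun t => hnorm2 (F t)).
Proof.
move=> sF; apply: (measurable_simple_hip sF) => v.
under eq_fun do rewrite hipC Re_conj.
by apply: (measurable_simple_hip sF) => w; exact: measurable_cst.
Qed.

Lemma strongly_measurable_hnorm2 G : strongly_measurable D G ->
  measurable_fun D (fun t => hnorm2 (G t)).
Proof.
move=> [s [ss sG]]; apply: (@measurable_fun_cvg _ _ _ D (fun m t => hnorm2 (s m t))).
- by move=> m; exact: measurable_simple_hnorm2.
- by move=> t Dt; apply: hcvg_hnorm2; exact: sG.
Qed.

Lemma measurable_EFin_hnorm2 G : strongly_measurable D G ->
  measurable_fun D (fun t => (hnorm2 (G t))%:E).
Proof. by move=> mG; apply/measurable_EFinP; exact: strongly_measurable_hnorm2. Qed.

Lemma simple_strongly_measurable F : simple_Hfun F -> strongly_measurable D F.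
Proof. by move=> sF; exists (fun=> F); split => // t _; exact: hcvg_cst. Qed.

Lemma strongly_measurableD F G : strongly_measurable D F ->
  strongly_measurable D G -> strongly_measurable D (fun t => F t + G t).
Proof.
move=> [s [ss sF]] [r [sr rG]]; exists (fun m t => s m t + r m t); split.
  by move=> m; exact: simple_HfunD.
by move=> t Dt; apply: hcvgD; [exact: sF|exact: rG].
Qed.

Lemma strongly_measurableZ (a : R[i]) F : strongly_measurable D F ->
  strongly_measurable D (fun t => a *: F t).
Proof.
move=> [s [ss sF]]; exists (fun m t => a *: s m t); split.
  by move=> m; exact: simple_HfunZ.
by move=> t Dt; apply: hcvgZ; exact: sF.
Qed.

Lemma strongly_measurableB F G : strongly_measurable D F ->
  strongly_measurable D G -> strongly_measurable D (fun t => F t - G t).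
Proof.
move=> mF mG; under eq_fun do rewrite -scaleN1r.
by apply: strongly_measurableD => //; exact: strongly_measurableZ.
Qed.

Definition sqnorm2 G : \bar R := (\int[mu]_(t in D) (hnorm2 (G t))%:E)%E.

Lemma sqnorm2_ge0 G : (0 <= sqnorm2 G)%E.
Proof. by apply: integral_ge0 => t _; rewrite lee_fin hnorm2_ge0. Qed.

Lemma sqnorm2Z (a : R[i]) F : strongly_measurable D F ->
  sqnorm2 (fun t => a *: F t) = ((sqnormc a)%:E * sqnorm2 F)%E.
Proof.
move=> mF; rewrite /sqnorm2; under eq_integral do rewrite hnorm2Z EFinM.
rewrite ge0_integralZl_EFin ?sqnormc_ge0//.
- by move=> t _; rewrite lee_fin hnorm2_ge0.
- exact: measurable_EFin_hnorm2.
Qed.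

Lemma sqnorm2D_le F G : strongly_measurable D F -> strongly_measurable D G ->
  (sqnorm2 (fun t => F t + G t)%R <= 2%:E * sqnorm2 F + 2%:E * sqnorm2 G)%E.
Proof.
move=> mF mG; have hF := measurable_EFin_hnorm2 mF; have hG := measurable_EFin_hnorm2 mG.
have m2 f : measurable_fun D f -> measurable_fun D (fun t => 2%:E * f t)%E.
  by move=> mf; exact: measurable_funeM.
rewrite /sqnorm2 -!ge0_integralZl_EFin//; last 2 first.
- by move=> t _; rewrite lee_fin hnorm2_ge0.
- by move=> t _; rewrite lee_fin hnorm2_ge0.
rewrite -ge0_integralD//; last 4 first.
- by move=> t _; rewrite -EFinM lee_fin mulr_ge0// hnorm2_ge0.
- exact: m2.
- by move=> t _; rewrite -EFinM lee_fin mulr_ge0// hnorm2_ge0.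
- exact: m2.
apply: ge0_le_integral => //.
- by move=> t _; rewrite lee_fin hnorm2_ge0.
- by apply: measurable_EFin_hnorm2; exact: strongly_measurableD.
- by apply: emeasurable_funD; exact: m2.
by move=> t _; rewrite -!EFinM -EFinD lee_fin hnorm2D_le.
Qed.

Lemma sqnorm2BC F G : sqnorm2 (fun t => F t - G t) = sqnorm2 (fun t => G t - F t).
Proof. by apply: eq_integral => t _; rewrite -hnorm2N opprB. Qed.

Lemma sqnorm2_le_via F E G : strongly_measurable D F -> strongly_measurable D E ->
  strongly_measurable D G ->
  (sqnorm2 (fun t => F t - G t)%R <=
    2%:E * sqnorm2 (fun t => F t - E t)%R + 2%:E * sqnorm2 (fun t => E t - G t)%R)%E.
Proof.
move=> mF mE mG; rewrite (_ : (fun t => F t - G t) =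
    fun t => (F t - E t) + (E t - G t)); last first.
  by apply/funext => t; rewrite addrA subrK.
by apply: sqnorm2D_le; exact: strongly_measurableB.
Qed.

(** Pointwise convergence yields strong measurability; convergence in norm lets a Cauchy sequence be
    replaced by simple functions. *)
Definition L2approx G : Prop := (sqnorm2 G < +oo)%E /\
  exists s : nat -> T -> H, [/\ forall m, simple_Hfun (s m),
    forall t, D t -> hcvg (s ^~ t) (G t) &
    sqnorm2 (fun t => s m t - G t) @[m --> \oo] --> 0%E].

Lemma L2approx_measurable G : L2approx G -> strongly_measurable D G.
Proof. by move=> [_ [s [ss sG _]]]; exists s. Qed.

Lemma L2approx_ex G (e : R) : L2approx G -> 0 < e ->
  exists2 s, simple_Hfun s & (sqnorm2 (fun t => s t - G t)%R < e%:E)%E.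
Proof.
move=> [_ [s [ss _ s0]]] e0.
have /s0 : nbhs (0%E : \bar R) [set x | (x < e%:E)%E].
  by apply: open_nbhs_nbhs; split; [exact: open_ereal_lt_ereal|rewrite /= lte_fin].
by move=> [N _ /(_ N (leqnn N)) sN]; exists (s N).
Qed.

Lemma cvge_le0 (u v : nat -> \bar R) : (forall n, 0 <= u n)%E ->
  (forall n, u n <= v n)%E -> v n @[n --> \oo] --> 0%E -> u n @[n --> \oo] --> 0%E.
Proof.
move=> u0 uv v0; apply: (@squeeze_cvge _ _ _ _ (fun=> 0%E) _ v) => //.
- by apply: nearW => n; rewrite u0 uv.
- exact: cvg_cst.
Qed.

Lemma cvge2D0 (u v : nat -> \bar R) (a b : R) : u n @[n --> \oo] --> 0%E ->
  v n @[n --> \oo] --> 0%E -> (a%:E * u n + b%:E * v n)%E @[n --> \oo] --> 0%E.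
Proof.
move=> u0 v0; rewrite -[X in _ --> X](adde0 0%E); apply: cvgeD => //.
  by rewrite -[X in _ --> X](mule0 a%:E); apply: cvgeZl.
by rewrite -[X in _ --> X](mule0 b%:E); apply: cvgeZl.
Qed.

Lemma L2approxD F G : L2approx F -> L2approx G -> L2approx (fun t => F t + G t).
Proof.
move=> aF aG; have [Foo [s [ss sF s0]]] := aF; have [Goo [r [sr rG r0]]] := aG.
have mF := L2approx_measurable aF; have mG := L2approx_measurable aG.
split.
  rewrite (le_lt_trans (sqnorm2D_le mF mG))// lte_add_pinfty// lte_mul_pinfty//.
exists (fun m t => s m t + r m t); split.
- by move=> m; exact: simple_HfunD.
- by move=> t Dt; apply: hcvgD; [exact: sF|exact: rG].
apply: (cvge_le0 _ _ (cvge2D0 2 2 s0 r0)) => m; first exact: sqnorm2_ge0.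
rewrite (_ : (fun t => _) = fun t => (s m t - F t) + (r m t - G t)); last first.
  by apply/funext => t; rewrite opprD addrACA.
by apply: sqnorm2D_le; apply: strongly_measurableB => //;
  exact: simple_strongly_measurable.
Qed.

Lemma L2approx0 : L2approx (fun=> 0).
Proof.
have n0 : sqnorm2 (fun=> 0) = 0%E.
  by rewrite /sqnorm2; under eq_integral do rewrite hnorm20; rewrite integral0.
split; first by rewrite n0.
exists (fun _ _ => 0); split => [m|t _|].
- exact: simple_Hfun_cst.
- exact: hcvg_cst.
- by under eq_fun do (under [X in sqnorm2 X]eq_fun do rewrite subr0); rewrite n0; exact: cvg_cst.
Qed.

(** [p] and [q] increase to the positive and negative parts of [f], so |p - q - f| <= |f| and f^2
    dominates the squared errors. *)
Lemma square_integrable_simple (f : T -> R) : measurable_fun D f ->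
  mu.-integrable D (fun t => (f t ^+ 2)%:E) ->
  exists p q : {nnsfun T >-> R}^nat,
    (forall t, D t -> p k t - q k t @[k --> \oo] --> f t) /\
    (\int[mu]_(t in D) ((p k t - q k t - f t) ^+ 2)%:E)%E @[k --> \oo] --> 0%E.
Proof.
move=> mf if2.
have mp : measurable_fun D (EFin \o f^\+) by apply/measurable_EFinP; exact: measurable_funrpos.
have mn : measurable_fun D (EFin \o f^\-) by apply/measurable_EFinP; exact: measurable_funrneg.
have p0 t : D t -> (0 <= (EFin \o f^\+)%R t)%E by rewrite lee_fin funrpos_ge0.
have n0 t : D t -> (0 <= (EFin \o f^\-)%R t)%E by rewrite lee_fin funrneg_ge0.
pose p := nnsfun_approx mD mp; pose q := nnsfun_approx mD mn.
have pf t : D t -> p k t @[k --> \oo] --> f^\+ t.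
  move=> Dt; have /fine_cvgP[_] := cvg_nnsfun_approx mD mp p0 Dt.
  exact.
have qf t : D t -> q k t @[k --> \oo] --> f^\- t.
  move=> Dt; have /fine_cvgP[_] := cvg_nnsfun_approx mD mn n0 Dt.
  exact.
have ple k t : D t -> p k t <= f^\+ t.
  move=> Dt; rewrite -(cvg_lim (@Rhausdorff R) (pf t Dt)).
  apply: (@nondecreasing_cvgn_le _ (fun k => p k t)); last by apply/cvg_ex; exists (f^\+ t); exact: pf.
  by move=> i j ij; have /lefP := nd_nnsfun_approx mD mp ij; exact.
have qle k t : D t -> q k t <= f^\- t.
  move=> Dt; rewrite -(cvg_lim (@Rhausdorff R) (qf t Dt)).
  apply: (@nondecreasing_cvgn_le _ (fun k => q k t)); last by apply/cvg_ex; exists (f^\- t); exact: qf.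
  by move=> i j ij; have /lefP := nd_nnsfun_approx mD mn ij; exact.
have fE t : f t = f^\+ t - f^\- t by rewrite -{1}(funrposBneg f).
have fD t : `|f t| = f^\+ t + f^\- t by rewrite -[LHS]/((Num.norm \o f) t) -funrposDneg.
have pqf t : D t -> p k t - q k t @[k --> \oo] --> f t.
  by move=> Dt; rewrite fE; apply: cvgB; [exact: pf|exact: qf].
exists p, q; split => //.
have mpq k : measurable_fun D (fun t => ((p k t - q k t - f t) ^+ 2)%:E).
  apply/measurable_EFinP; apply: measurable_funX; apply: measurable_funB => //.
  by apply: measurable_funB; apply: measurable_funTS; exact: measurable_funP.
have := @dominated_convergence _ _ _ mu D mD
  (fun k t => ((p k t - q k t - f t) ^+ 2)%:E) (fun=> 0%E) (fun t => (f t ^+ 2)%:E) mpq.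
move=> /(_ (measurable_cst _)) -[].
- apply: aeW => t Dt; apply/fine_cvgP; split; first exact: nearW.
  have z : (fun k => p k t - q k t - f t) @ \oo --> (0 : R).
    by rewrite -(subrr (f t)); apply: cvgB; [exact: pqf|exact: cvg_cst].
  rewrite (_ : _ \o _ = fun k => (p k t - q k t - f t) * (p k t - q k t - f t)).
    by rewrite -[X in _ --> X](mulr0 (0 : R)); exact: cvgM.
  by apply/funext => k /=; rewrite expr2.
- exact: if2.
- apply: aeW => t k Dt; rewrite gee0_abs ?lee_fin ?sqr_ge0//.
  rewrite -[leRHS]real_normK ?num_real// -[leLHS]real_normK ?num_real//.
  rewrite ler_pXn2r ?nnegrE ?normr_ge0//.
  have p0t : 0 <= p k t by exact: fun_ge0.
  have q0t : 0 <= q k t by exact: fun_ge0.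
  move: (ple k t Dt) (qle k t Dt) p0t q0t; rewrite fD fE.
  move: (p k t) (q k t) (f^\+ t) (f^\- t) => x y a b xa yb x0 y0.
  by rewrite ler_norml; apply/andP; split; lra.
- by move=> _ _; rewrite integral0.
Qed.

End bochner_square_integrable.

(** * Completeness of L^2 with values in a Hilbert space *)

Section riesz_fischer.
Import HBNNSimple.
Context (R : realType) d (T : measurableType d) (mu : {measure set T -> \bar R}).
Variables (D : set T) (mD : measurable D) (H : hilbert R).
Implicit Types F G : T -> H.
Local Notation N2 := (sqnorm2 mu D).

Lemma L2approx_real (f : T -> R) (v : H) : measurable_fun D f ->
  mu.-integrable D (fun t => (f t ^+ 2)%:E) ->
  L2approx mu D (fun t => (f t)%:C%C *: v).
Proof.
move=> mf if2; have [p [q [pqf i0]]] := square_integrable_simple mD mf if2.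
have Zr (a : R) (w : H) : hnorm2 (a%:C%C *: w) = a ^+ 2 * hnorm2 w.
  by rewrite hnorm2Z /sqnormc /= expr0n addr0.
have v0 := hnorm2_ge0 v.
have mf2 : measurable_fun D (fun t => (f t ^+ 2)%:E).
  by apply/measurable_EFinP; exact: measurable_funX.
split.
  rewrite /sqnorm2; under eq_integral do rewrite Zr mulrC EFinM.
  rewrite ge0_integralZl_EFin//; last by move=> t _; rewrite lee_fin sqr_ge0.
  rewrite lte_mul_pinfty ?lee_fin//.
  by have := integrable_lty mD if2.
exists (fun m t => (p m t)%:C%C *: v + (-1) *: ((q m t)%:C%C *: v)); split.
- move=> m; apply: simple_HfunD; first exact: simple_Hfun_nnsfun.
  by apply: simple_HfunZ; exact: simple_Hfun_nnsfun.
- move=> t Dt; rewrite /hcvg.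
  rewrite (_ : (fun m => _) = fun m => `|p m t - q m t - f t| * hnorm v); last first.
    by apply/funext => m; rewrite -hnormZr !rmorphB /= !scalerBl scaleN1r.
  rewrite -[X in _ --> X](mul0r (hnorm v)); apply: cvgMl => //.
  rewrite -[X in _ --> X](normr0 R); apply: cvg_norm.
  by rewrite -(subrr (f t)); apply: cvgB; [exact: pqf|exact: cvg_cst].
rewrite (_ : (fun m => _) = fun m => ((hnorm2 v)%:E *
    \int[mu]_(t in D) ((p m t - q m t - f t) ^+ 2)%:E)%E); last first.
  apply/funext => m; rewrite -ge0_integralZl_EFin//.
  - apply: eq_integral => t _; rewrite -EFinM mulrC -Zr !rmorphB /= !scalerBl.
    by rewrite scaleN1r.
  - by move=> t _; rewrite lee_fin sqr_ge0.
  - apply/measurable_EFinP; apply: measurable_funX; apply: measurable_funB => //.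
    by apply: measurable_funB; apply: measurable_funTS; exact: measurable_funP.
by rewrite -[X in _ --> X](mule0 (hnorm2 v)%:E); apply: cvgeZl.
Qed.

Lemma L2approx_scale (c : T -> R[i]) (v : H) : sqint mu D c ->
  L2approx mu D (fun t => c t *: v).
Proof.
move=> sc; have [cRe cIm _] := sc; have ic := sqint_integrable sc.
have i2 (f : T -> R) : measurable_fun D f ->
    (forall t, f t ^+ 2 <= sqnormc (c t)) -> mu.-integrable D (fun t => (f t ^+ 2)%:E).
  move=> mf fc; apply: (le_integrable mD _ _ ic).
    by apply/measurable_EFinP; exact: measurable_funX.
  by move=> t _; rewrite !gee0_abs ?lee_fin ?sqr_ge0// sqnormc_ge0.
rewrite (_ : (fun t => _) = fun t => (complex.Re (c t))%:C%C *: v +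
    (complex.Im (c t))%:C%C *: ('i%C *: v)); last first.
  by apply/funext => t; rewrite scalerA -scalerDl [c t in LHS]complexE mulrC.
apply: (L2approxD mD); apply: L2approx_real => //; apply: i2 => // t.
  by rewrite /sqnormc lerDl sqr_ge0.
by rewrite /sqnormc lerDr sqr_ge0.
Qed.

Lemma L2approx_sum (l : seq ((T -> R[i]) * H)) :
  (forall cv, List.In cv l -> sqint mu D cv.1) ->
  L2approx mu D (fun t => \sum_(cv <- l) cv.1 t *: cv.2).
Proof.
elim: l => [|cv l IH] sl.
  by under eq_fun do rewrite big_nil; exact: L2approx0.
under eq_fun do rewrite big_cons.
apply: (L2approxD mD); first by apply: L2approx_scale; apply: sl; left.
by apply: IH => cw cwl; apply: sl; right.
Qed.

Lemma geo_sum_le (N : nat) : \sum_(0 <= i < N) (2^-1 : R) ^+ i <= 2.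
Proof.
have -> : \sum_(0 <= i < N) (2^-1 : R) ^+ i = 2 - 2 * 2^-1 ^+ N.
  elim: N => [|N IH]; first by rewrite big_nil expr0; ring.
  by rewrite big_nat_recr//= IH exprS; field.
by rewrite gerBl mulr_ge0// exprn_ge0// invr_ge0.
Qed.

(* Fast L^2-Cauchy sequences of simple functions converge. The function
   [A = sum_m 4^m |s_(m+1) - s_m|^2] is integrable, and at a point where it is
   finite the increments of [s] decay like [2^-m]. *)
Lemma simple_fast_cauchy (s : nat -> T -> H) (C : R) :
  (forall m, simple_Hfun (s m)) ->
  (forall m, (N2 (fun t => s m.+1 t - s m t)%R <= (C * 8^-1 ^+ m)%:E)%E) ->
  exists G, strongly_measurable D G /\
    N2 (fun t => s m t - G t) @[m --> \oo] --> 0%E.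
Proof.
move=> ss sC.
have C0 : 0 <= C.
  by have := le_trans (sqnorm2_ge0 _ _ _) (sC 0%N); rewrite expr0 mulr1 lee_fin.
have smd m : strongly_measurable D (fun t => s m.+1 t - s m t).
  by apply: strongly_measurableB; exact: simple_strongly_measurable.
(* The weight 4^m turns the rate 8^-m of the squared norms into 2^-m, still summable, and leaves the
   pointwise decay |s_(m+1) - s_m|^2 <= A 4^-m. *)
pose u m t : \bar R := (4 ^+ m * hnorm2 (s m.+1 t - s m t))%:E.
have u0 m t : (0 <= u m t)%E by rewrite lee_fin mulr_ge0 ?hnorm2_ge0 ?exprn_ge0.
have mu_ m : measurable_fun D (u m).
  apply/measurable_EFinP; apply: measurable_funM; first exact: measurable_cst.
  by have := strongly_measurable_hnorm2 (smd m).
pose A t := (\sum_(m <oo) u m t)%E.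
have A0 t : (0 <= A t)%E by apply: nneseries_ge0 => m _ _; exact: u0.
have mA : measurable_fun D A by apply: ge0_emeasurable_sum => // m t _ _; exact: u0.
have iA : (\int[mu]_(t in D) A t <= (C * 2)%:E)%E.
  rewrite integral_nneseries//.
  apply: lime_le.
    by apply: is_cvg_nneseries => m _ _; apply: integral_ge0 => t _; exact: u0.
  apply: nearW => N.
  apply: (@le_trans _ _ (\sum_(0 <= m < N) (C * 2^-1 ^+ m)%:E)%E).
    apply: lee_sum => m _; rewrite /u.
    under eq_integral do rewrite EFinM.
    rewrite ge0_integralZl_EFin//; last 2 first.
    - by move=> t _; rewrite lee_fin hnorm2_ge0.
    - by have := measurable_EFin_hnorm2 (smd m).
    apply: (le_trans (lee_wpmul2l _ (sC m))); first by rewrite lee_fin exprn_ge0.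
    rewrite -EFinM lee_fin mulrCA -exprMn.
    by rewrite (_ : 4 * 8^-1 = 2^-1 :> R)//; field.
  by rewrite sumEFin lee_fin -mulr_sumr ler_wpM2l// geo_sum_le.
pose E := D `&` [set t | (A t < +oo)%E].
have mE : measurable E by exact: emeasurable_fun_infty_o.
pose r (t : T) : R := Num.sqrt (fine (A t)).
have step t m : E t -> hnorm (s m.+1 t - s m t) <= r t * 2^-1 ^+ m.
  move=> [_ At]; have fA : A t \is a fin_num by rewrite ge0_fin_numE.
  rewrite -(@ler_pXn2r _ 2)// ?nnegrE ?hnorm_ge0 ?mulr_ge0 ?sqrtr_ge0 ?exprn_ge0 ?invr_ge0//.
  rewrite sqr_hnorm exprMn sqr_sqrtr ?fine_ge0// -exprM mulnC exprM.
  rewrite -ler_pdivrMr ?exprn_gt0 ?exprn_gt0 ?invr_gt0// -lee_fin fineK//.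
  rewrite (_ : _ / _ = 4 ^+ m * hnorm2 (s m.+1 t - s m t)); last first.
    rewrite mulrC exprVn exprVn invrK; congr (_ ^+ _ * _); ring.
  have := @nneseries_lim_ge R (u^~ t) xpredT 0%N m.+1 (fun n _ _ => u0 n t).
  apply: le_trans; rewrite big_nat_recr//= leeDr//.
  by apply: sume_ge0 => i _; exact: u0.
have dist t m k : E t -> hnorm (s (m + k)%N t - s m t) <= 2 * r t * 2^-1 ^+ m.
  move=> Et; have r0 : 0 <= r t by exact: sqrtr_ge0.
  apply: (@le_trans _ _ (\sum_(0 <= i < k) r t * 2^-1 ^+ (m + i))).
    elim: k => [|k IH]; first by rewrite addn0 subrr hnorm0 big_nil.
    rewrite big_nat_recr//= addnS.
    rewrite -(subrK (s (m + k)%N t) (s (m + k).+1 t)) -addrA addrC.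
    by apply: (le_trans (hnormD_le _ _)); apply: lerD => //; exact: step.
  rewrite (_ : \sum_(0 <= i < k) _ = r t * 2^-1 ^+ m * \sum_(0 <= i < k) 2^-1 ^+ i).
    rewrite -[leRHS]mulrA [leRHS]mulrC; apply: ler_wpM2l (geo_sum_le k).
    by rewrite mulr_ge0// exprn_ge0// invr_ge0.
  by rewrite mulr_sumr; apply: eq_bigr => i _; rewrite exprD mulrA.
(* Strong measurability asks for convergence at every point of [D]; setting the limit to 0 off [E]
   makes the simple functions restricted to [E] converge to it there too. *)
have /choice[G GE] : forall t, exists l, (E t -> hcvg (s ^~ t) l) /\ (~ E t -> l = 0).
  move=> t; have [Et|nEt] := pselect (E t); last by exists 0.
  have r0 : 0 <= r t by exact: sqrtr_ge0.
  have [e e0|l sl] := @hcomplete R H (s^~ t); last by exists l.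
  have g0 : geometric (4 * r t) 2^-1 @ \oo --> (0 : R).
    by apply: cvg_geometric; rewrite ger0_norm ?invr_ge0// invf_lt1// ltr1n.
  have /cvgrPdist_lt/(_ e e0)[N _ /(_ N (leqnn N))] := g0.
  rewrite /= sub0r normrN ger0_norm ?mulr_ge0 ?exprn_ge0 ?invr_ge0// => Ne.
  exists N => p q Np Nq; apply: le_lt_trans Ne.
  rewrite -(subrK (s N t) (s p t)) -addrA -/(hnorm _).
  apply: (le_trans (hnormD_le _ _)); rewrite [X in _ + X]hnormB -(subnKC Np) -(subnKC Nq).
  have := dist t N (p - N)%N Et; have := dist t N (q - N)%N Et; lra.
have distG t m : E t -> hnorm (s m t - G t) <= 2 * r t * 2^-1 ^+ m.
  move=> Et; apply/ler_addgt0Pr => e e0.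
  have /cvgrPdist_lt/(_ e e0)[N _ /(_ (m + N)%N (leq_addl _ _))] := (GE t).1 Et.
  rewrite /= sub0r normrN ger0_norm ?hnorm_ge0// => Ne.
  rewrite -(subrK (s (m + N)%N t) (s m t)) -addrA.
  apply: (le_trans (hnormD_le _ _)); apply: lerD; last exact: ltW.
  by rewrite hnormB; exact: dist.
have smG : strongly_measurable D G.
  exists (fun m t => (\1_E t : R)%:C%C *: s m t); split.
    by move=> m; exact: simple_Hfun_restrict.
  move=> t Dt; have [Et|nEt] := pselect (E t).
    rewrite indicE mem_set//; under eq_fun do rewrite scale1r.
    exact: (GE t).1.
  rewrite indicE memNset// (GE t).2//; under eq_fun do rewrite scale0r.
  exact: hcvg_cst.
exists G; split => //.
have b0 m : 0 <= 4 * 4^-1 ^+ m :> R by rewrite mulr_ge0// exprn_ge0// invr_ge0.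
have bound m : (N2 (fun t => s m t - G t)%R <= (4 * 4^-1 ^+ m)%:E * (C * 2)%:E)%E.
  apply: (@le_trans _ _ ((4 * 4^-1 ^+ m)%:E * \int[mu]_(t in D) A t)%E); last first.
    by apply: lee_wpmul2l => //; rewrite lee_fin.
  rewrite -ge0_integralZl_EFin//.
  apply: ge0_le_integral => //.
  - by move=> t _; rewrite lee_fin hnorm2_ge0.
  - by apply: measurable_EFin_hnorm2 => //; apply: strongly_measurableB => //;
      exact: simple_strongly_measurable.
  - exact: measurable_funeM.
  (* Where [A] is infinite the right-hand side is +oo, so the complement of [E] is absorbed in the
     inequality. *)
  move=> t Dt; have [At|nAt] := pselect (A t < +oo)%E; last first.
    have -> : A t = +oo%E by apply/eqP; rewrite -leye_eq leNgt; apply/negP.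
    by rewrite gt0_muley ?leey// lte_fin mulr_gt0// exprn_gt0// invr_gt0.
  have Et : E t by [].
  rewrite -(@fineK _ (A t)) ?ge0_fin_numE// -EFinM lee_fin -sqr_hnorm.
  apply: (@le_trans _ _ ((2 * r t * 2^-1 ^+ m) ^+ 2)).
    rewrite ler_pXn2r ?nnegrE ?hnorm_ge0 ?mulr_ge0 ?sqrtr_ge0 ?exprn_ge0 ?invr_ge0//.
    exact: distG.
  rewrite !exprMn sqr_sqrtr ?fine_ge0// -exprM mulnC exprM.
  rewrite (_ : (2^-1 ^+ 2 : R) = 4^-1); last by field.
  by rewrite (_ : (2 ^+ 2 : R) = 4) 1?mulrAC//; ring.
apply: (cvge_le0 _ bound) => [m|]; first exact: sqnorm2_ge0.
have -> : (fun m => (4 * 4^-1 ^+ m)%:E * (C * 2)%:E)%E =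
    EFin \o (fun m => (8 * C) * 4^-1 ^+ m).
  by apply/funext => m /=; rewrite -EFinM; congr EFin; ring.
apply: cvg_EFin; first exact: nearW.
by apply: (@cvg_geometric R); rewrite ger0_norm ?invr_ge0// invf_lt1// ltr1n.
Qed.

End riesz_fischer.

Section bochner_completeness.
Context (R : realType) d (T : measurableType d) (mu : {measure set T -> \bar R}).
Variables (D : set T) (mD : measurable D) (H : hilbert R).
Local Notation N2 := (sqnorm2 mu D).

Lemma geometric_cvg0 (a z : R) : 0 <= z < 1 -> a * z ^+ n @[n --> \oo] --> (0 : R).
Proof.
by move=> /andP[z0 z1]; apply: (@cvg_geometric R a z); rewrite ger0_norm.
Qed.

(** A subsequence with squared increments below 8^-k is replaced by simple functions within 8^-k, to
    which [simple_fast_cauchy] applies. A subsequence suffices, since the closure only asks for some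
    approximating sequence. *)
Lemma L2approx_complete (G : nat -> T -> H) : (forall m, L2approx mu D (G m)) ->
  (forall e : R, 0 < e -> exists N, forall p q, (N <= p)%N -> (N <= q)%N ->
    (N2 (fun t => G p t - G q t)%R < e%:E)%E) ->
  exists (phi : nat -> nat) L, [/\ forall k, (k <= phi k)%N,
    strongly_measurable D L, (N2 L < +oo)%E &
    N2 (fun t => G (phi k) t - L t) @[k --> \oo] --> 0%E].
Proof.
move=> aG cauchy.
have e0 k : 0 < 8^-1 ^+ k :> R by rewrite exprn_gt0// invr_gt0.
have /choice[N NG] := fun k => cauchy _ (e0 k).
(* The sum bounds all of N 0, ..., N k without any monotonicity of [N], and the summand k makes
   [phi k] tend to infinity. *)
pose phi k := (k + \sum_(j < k.+1) N j)%N.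
have Nphi j k : (j <= k)%N -> (N j <= phi k)%N.
  move=> jk; have jk1 : (j < k.+1)%N by rewrite ltnS.
  by rewrite /phi (bigD1 (Ordinal jk1))//= addnCA leq_addr.
have /choice[s sG] : forall k, exists s, simple_Hfun s /\
    (N2 (fun t => s t - G (phi k) t)%R < (8^-1 ^+ k)%:E)%E.
  by move=> k; have [s ? ?] := L2approx_ex (aG (phi k)) (e0 k); exists s.
have ss k : simple_Hfun (s k) by have [] := sG k.
have ms k := simple_strongly_measurable D (ss k).
have mG k := L2approx_measurable (aG k).
(* Going through two intermediate functions costs 2/8 + 2 (2 + 2) = 8.25 times 8^-k, rounded up to
   10. *)
have inc k : (N2 (fun t => s k.+1 t - s k t)%R <= (10 * 8^-1 ^+ k)%:E)%E.
  apply: le_trans (sqnorm2_le_via mu mD (ms k.+1) (mG (phi k.+1)) (ms k)) _.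
  have h1 := ltW (sG k.+1).2.
  have h2 := sqnorm2_le_via mu mD (mG (phi k.+1)) (mG (phi k)) (ms k).
  have h3 := ltW (NG k (phi k.+1) (phi k) (Nphi k k.+1 (leqnSn k)) (Nphi k k (leqnn k))).
  have h4 := ltW (sG k).2; rewrite sqnorm2BC in h4.
  have two0 : (0 <= 2%:E :> \bar R)%E by rewrite lee_fin.
  have h5 := le_trans h2 (leeD (lee_wpmul2l two0 h3) (lee_wpmul2l two0 h4)).
  apply: le_trans (leeD (lee_wpmul2l two0 h1) (lee_wpmul2l two0 h5)) _.
  do ![rewrite -EFinM|rewrite -EFinD]; rewrite lee_fin exprS.
  by have := e0 k; move: (8^-1 ^+ k) => x x0; lra.
have [L [mL sL]] := simple_fast_cauchy mD ss inc.
have GL : N2 (fun t => G (phi k) t - L t) @[k --> \oo] --> 0%E.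
  have sG0 : N2 (fun t => s k t - G (phi k) t) @[k --> \oo] --> 0%E.
    apply: (@cvge_le0 _ _ (fun k => (1 * 8^-1 ^+ k)%:E)) => [k|k|].
    - exact: sqnorm2_ge0.
    - by rewrite mul1r; exact: ltW (sG k).2.
    apply: cvg_EFin; first exact: nearW.
    by apply: geometric_cvg0; apply/andP; split; lra.
  apply: (@cvge_le0 _ _ _ _ _ (cvge2D0 2 2 sG0 sL)) => k; first exact: sqnorm2_ge0.
  by rewrite [in leRHS]sqnorm2BC; exact: sqnorm2_le_via.
exists phi, L; split => //; first by move=> k; exact: leq_addr.
have /GL : nbhs (0%E : \bar R) [set x | (x < 1%:E)%E].
  by apply: open_nbhs_nbhs; split; [exact: open_ereal_lt_ereal|rewrite /= lte_fin].
move=> [k _ /(_ k (leqnn k)) GL1].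
rewrite (_ : L = fun t => G (phi k) t - (G (phi k) t - L t)); last first.
  by apply/funext => t; rewrite opprB addrC subrK.
rewrite (_ : (fun t => _) = fun t => G (phi k) t + (-1) *: (G (phi k) t - L t)); last first.
  by apply/funext => t; rewrite scaleN1r.
have mGL : strongly_measurable D (fun t => G (phi k) t - L t).
  exact: strongly_measurableB.
apply: le_lt_trans (sqnorm2D_le mu mD (mG _) (strongly_measurableZ (-1) mGL)) _.
rewrite sqnorm2Z// lte_add_pinfty// lte_mul_pinfty//; first by have [] := aG (phi k).
rewrite lte_mul_pinfty ?lee_fin ?sqnormc_ge0//.
by apply: lt_trans GL1 _; rewrite ltry.
Qed.

Lemma measurable_Re_hip (G : T -> H) (v : H) : strongly_measurable D G ->
  measurable_fun D (fun t => complex.Re (hip (G t) v)).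
Proof.
move=> [s [ss sG]].
apply: (@measurable_fun_cvg _ _ _ D (fun m t => complex.Re (hip (s m t) v))).
  by move=> m; apply: (measurable_simple_hip (ss m)) => w; exact: measurable_cst.
move=> t Dt.
have b0 : (fun m => hnorm (s m t - G t) * hnorm v) @ \oo --> (0 : R).
  by rewrite -[X in _ --> X](mul0r (hnorm v)); apply: cvgMl => //; exact: sG.
have : (fun m => complex.Re (hip (s m t - G t) v)) @ \oo --> (0 : R).
  apply: (@squeeze_cvgr _ _ _ _ (fun m => - (hnorm (s m t - G t) * hnorm v))
      (fun m => hnorm (s m t - G t) * hnorm v)) => //.
  - near=> m; rewrite Re_hip_le andbT lerNl -ReN.
    by rewrite -[leLHS]/(complex.Re (- hip _ _)) -sub0r -(hip0l v) -hipBl sub0r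
      -(hnormN (s m t - G t)) Re_hip_le.
  - by rewrite -oppr0; exact: cvgN.
move=> h; rewrite -[X in _ --> X]add0r.
rewrite (_ : (fun m => _) = fun m => complex.Re (hip (s m t - G t) v) + complex.Re (hip (G t) v)).
  by apply: cvgD => //; exact: cvg_cst.
by apply/funext => m; rewrite -ReD -hipDl subrK.
Unshelve. all: by end_near. Qed.

Lemma measurable_Im_hip (G : T -> H) (v : H) : strongly_measurable D G ->
  measurable_fun D (fun t => complex.Im (hip (G t) v)).
Proof.
move=> mG; rewrite (_ : (fun t => _) = fun t => complex.Re (hip (G t) ('i%C *: v))).
  exact: measurable_Re_hip.
by apply/funext => t; rewrite hipZr ReM Re_conj Im_conj /= mul0r mulNr mul1r sub0r opprK.
Qed.

Lemma hcvg_subseq (u : nat -> H) (l : H) (phi : nat -> nat) :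
  (forall k, (k <= phi k)%N) -> hcvg u l -> hcvg (fun k => u (phi k)) l.
Proof.
move=> phik ul A /ul[N _ NA]; exists N => // k /= Nk.
by apply: NA; exact: leq_trans (phik k).
Qed.

End bochner_completeness.

(** * Passage to the closure *)

Section stroock.
Variables (R : realType) (Fk : fock R) (L2 : forall k, L2SC Fk k).
Local Notation mR := (measurableTypeR R).
Local Notation Omega := (vacuum Fk).

Lemma M2norm2E n (G : n.-tuple mR -> L2 n) :
  M2norm2 G = sqnorm2 (@leb R n) (@Rplusn R n) G.
Proof. by []. Qed.

Lemma L2approx_nabla n P :
  L2approx (@leb R n) (@Rplusn R n) (fun t => nabla_alg L2 P t).
Proof.
have [l [lL lE]] := L2comb_nabla L2 n P.
rewrite (_ : (fun t => _) = fun t => \sum_(cv <- l) cv.1 t *: cv.2); last exact/funext.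
by apply: L2approx_sum => //; exact: measurable_Rplusn.
Qed.

(** Serves with the factor n! to obtain a representative of D^n F from one of nabla^n F, and with
    its inverse to go back. *)
Lemma closure_ofZ n (a : R[i]) (T0 : scalg R -> n.-tuple mR -> L2 n) F G :
  (forall P, strongly_measurable (@Rplusn R n) (T0 P)) ->
  closure_of T0 F G -> closure_of (fun P t => a *: T0 P t) F (fun t => a *: G t).
Proof.
have mD := @measurable_Rplusn R n.
move=> mT [[mG Goo] [P [PF PG]]]; split; first split.
- exact: strongly_measurableZ.
- by rewrite M2norm2E sqnorm2Z// lte_mul_pinfty ?lee_fin ?sqnormc_ge0.
exists P; split => //.
rewrite (_ : (fun m => _) = fun m => ((sqnormc a)%:E * M2norm2 (fun t => T0 (P m) t - G t)%R)%E).
  by rewrite -[X in _ --> X](mule0 (sqnormc a)%:E); apply: cvgeZl.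
apply/funext => m; rewrite !M2norm2E -sqnorm2Z//.
  by apply: eq_integral => t _; rewrite scalerBr.
exact: strongly_measurableB.
Qed.

(** In positive degree one term of the Sobolev sum suffices, as (n!)^2 >= 1. That sum starts at 1,
    so degree zero is compared with the L^2 norm instead: nabla^0 P is constant on a point of mass
    1. *)
Lemma M2norm2_nabla_le n k P : (n <= k)%N ->
  (M2norm2 (fun t : n.-tuple mR => nabla_alg L2 P t) <= sobolev_norm2 L2 k P)%E.
Proof.
have s0 : (0 <= \sum_(1 <= j < k.+1) M2norm2 (fun t => @D_alg _ _ L2 j P t))%E.
  by apply: sume_ge0 => j _; exact: sqnorm2_ge0.
case: n => [_|n nk].
  rewrite -[leLHS]adde0; apply: leeD => //.
  rewrite /M2norm2 (eq_integral (fun=> (hnorm2 (scval L2 P))%:E)).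
    rewrite integral_cst; last exact: measurable_Rplusn.
    by rewrite [X in (_ * X)%E](leb0_Rplusn R) mule1.
  move=> t _; congr (hnorm2 _)%:E; rewrite tuple0 /nabla_alg /= big_seq1.
  by rewrite /tensval /scval; congr Lam; apply/funext => i; rewrite ord1.
apply: (@le_trans _ _ (M2norm2 (fun t : n.+1.-tuple mR => D_alg L2 P t))).
  rewrite [leRHS]M2norm2E sqnorm2Z; last 2 first.
  - exact: measurable_Rplusn.
  - exact: L2approx_measurable (L2approx_nabla _ _).
  rewrite -[leLHS]mul1e; apply: lee_wpmul2r; first exact: sqnorm2_ge0.
  rewrite -(rmorph_nat (real_complex R)) /sqnormc /= expr0n addr0 lee_fin.
  by rewrite exprn_ege1// ler1n fact_gt0.
rewrite -[leLHS]add0e; apply: leeD; first by rewrite lee_fin hnorm2_ge0.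
rewrite (bigD1_seq n.+1)//= ?mem_index_iota ?iota_uniq// leeDl//.
by apply: sume_ge0 => j _; exact: sqnorm2_ge0.
Qed.

Lemma is_nabla_ex n (F : L2 0%N) : Dinf2sigma F ->
  exists G, is_nabla (L2 := L2) (n := n) F G.
Proof.
(* The maximum with 1 covers n = 0, as the domain only speaks of orders k >= 1. *)
move=> /(_ (maxn 1 n) (leq_maxl _ _))[P [PF cauchy]].
have [e e0|phi [G [phik mG Goo PG]]] := @L2approx_complete _ _ _ (@leb R n) _
    (@measurable_Rplusn R n) _ (fun m t => nabla_alg L2 (P m) t) (fun m => L2approx_nabla _ _).
  have [N NP] := cauchy e e0; exists N => p q Np Nq.
  apply: le_lt_trans (NP p q Np Nq).
  apply: le_trans (M2norm2_nabla_le (SCsub (P p) (P q)) (leq_maxr 1 n)).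
  by under [leRHS]eq_integral do rewrite nabla_algB.
exists G; split; first by split.
by exists (P \o phi); split => //; exact: (hcvg_subseq phik PF).
Qed.

Section kernel_identity.
Variables (U : L2 0%N -> Fk) (HU : vacuum_unitary U) (F : L2 0%N).
Variable f : forall n, n.-tuple mR -> R[i].
Arguments f : clear implicits.
Hypothesis Hf : forall n, L2n (f n).
Hypothesis HFf : chaos_expansion U F f.

Lemma U_chaos_sum N : U (\sum_(k < N) wigner U (f k)) = \sum_(k < N) chaos Fk (f k).
Proof.
have [UL _ Usurj _] := HU; rewrite linear_big_sum//; apply: eq_bigr => k _.
(* Surjectivity of [U] ensures that the choice in [wigner] is a true preimage and not its default
   0. *)
by rewrite /wigner; apply: (@xgetPex _ 0 [set J | U J = chaos Fk (f k)]); exact: Usurj.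
Qed.

(** The pairing of a partial sum with a chaos of degree n no longer changes once it contains that
    degree; Cauchy-Schwarz carries this to the limit. *)
Lemma hip_U_chaos n (g : n.-tuple mR -> R[i]) : L2n g ->
  hip (U F) (chaos Fk g) = hip (chaos Fk (f n)) (chaos Fk g).
Proof.
move=> gL; have [UL Unorm _ _] := HU.
apply/eqP; rewrite -subr_eq0; apply/eqP/sqnormc_eq0/eqP.
rewrite eq_le sqnormc_ge0 andbT.
have S N : (n < N)%N -> hip (\sum_(k < N) chaos Fk (f k)) (chaos Fk g) =
    hip (chaos Fk (f n)) (chaos Fk g).
  move=> nN; rewrite hip_suml (bigD1 (Ordinal nN))//= big1 ?addr0// => j jn.
  by apply: hip_chaos_neq => // jn'; move/eqP: jn; apply; exact: val_inj.
have b0 : (fun N => hnorm2 (\sum_(k < N) wigner U (f k) - F) * hnorm2 (chaos Fk g)) @ \oo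
    --> (0 : R).
  rewrite -[X in _ --> X](mul0r (hnorm2 (chaos Fk g))); apply: cvgMl => //.
  rewrite -(hnorm20 (L2 0%N)); apply: hcvg_hnorm2; rewrite /hcvg.
  by under eq_fun do rewrite subr0.
apply: (cvgr_to_ge b0); exists n.+1 => // N /= nN.
rewrite -(S N nN) -hipBl -sqr_hnorm hnormB -Unorm (linear_sub _ _ UL) U_chaos_sum sqr_hnorm.
exact: sqnormc_hip_le.
Qed.

(** The chaos of the difference of the kernels is the projection of U F - P Omega to degree n.
    Pairing U F - P Omega with that chaos gives its squared norm, and Cauchy-Schwarz gives the
    bound. *)
Lemma L2_dist_kernel n P :
  (\int[@leb R n]_(t in @Rplusn R n)
    (sqnormc (f n t - tautens (nabla_alg L2 P t)))%:E <=
   (hnorm2 (scval L2 P - F))%:E)%E.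
Proof.
have [UL Unorm _ Uvac] := HU.
pose k (t : n.-tuple mR) : R[i] := tautens (nabla_alg L2 P t).
pose a (t : n.-tuple mR) : R[i] := -1 * k t + f n t.
have kL : L2n k by exact: L2n_tautens_nabla.
have aL : L2n a by exact: (sqint_lin (@measurable_Rplusn R n) _ kL (Hf n)).
have aE : chaos Fk a = (-1) *: chaos Fk k + chaos Fk (f n) by exact: chaos_linear.
have := sqint_integrable aL => ia.
have -> : (\int[@leb R n]_(t in @Rplusn R n) (sqnormc (f n t - k t))%:E =
    \int[@leb R n]_(t in @Rplusn R n) (sqnormc (a t))%:E)%E.
  by apply: eq_integral => t _; rewrite /a mulN1r addrC.
have -> : (\int[@leb R n]_(t in @Rplusn R n) (sqnormc (a t))%:E =
    (hnorm2 (chaos Fk a))%:E)%E.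
  rewrite -[LHS]fineK; last exact: (integrable_fin_num (@measurable_Rplusn R n) ia).
  congr _%:E; have := hipxx (chaos Fk a).
  by rewrite hip_chaos// /L2ndot L2dotxx// => /(@complexI R) <-.
rewrite lee_fin.
have key : hip (U F - sceval P Omega) (chaos Fk a) = (hnorm2 (chaos Fk a))%:C%C.
  rewrite hipBl hip_U_chaos// (hip_sceval_chaos L2)// -hipBl -hipxx aE.
  by congr (hip _ _); rewrite scaleN1r addrC.
have := sqnormc_hip_le (U F - sceval P Omega) (chaos Fk a).
rewrite key {1}/sqnormc /= expr0n addr0 expr2.
rewrite (_ : hnorm2 (U F - _) = hnorm2 (scval L2 P - F)); last first.
  rewrite -Uvac; last exact: SC_sceval.
  by rewrite -!sqr_hnorm hnormB -(linear_sub _ _ UL) Unorm.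
have [->|x0] := eqVneq (hnorm2 (chaos Fk a)) 0; first by rewrite hnorm2_ge0.
by rewrite ler_pM2r// lt_neqAle eq_sym x0 hnorm2_ge0.
Qed.

Lemma is_nabla_kernel n G : is_nabla (L2 := L2) (n := n) F G ->
  {ae @leb R n, forall t, Rplusn t -> f n t = tautens (G t)}.
Proof.
move=> [[mG _] [P [PF PG]]].
have mD := @measurable_Rplusn R n.
have [fRe fIm _] := Hf n.
have mRe := measurable_Re_hip (Lam (L2 n) (fun=> id)) mG.
have mIm := measurable_Im_hip (Lam (L2 n) (fun=> id)) mG.
pose h t := f n t - tautens (G t).
have mh : measurable_fun (@Rplusn R n) (fun t => sqnormc (h t)).
  apply: measurable_sqnormc.
    by under eq_fun do rewrite ReD ReN; exact: measurable_funB.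
  by under eq_fun do rewrite ImD ImN; exact: measurable_funB.
pose I := (\int[@leb R n]_(t in @Rplusn R n) (sqnormc (h t))%:E)%E.
have I0 : (0 <= I)%E by apply: integral_ge0 => t _; rewrite lee_fin sqnormc_ge0.
have mP m : strongly_measurable (@Rplusn R n) (fun t => nabla_alg L2 (P m) t).
  exact: L2approx_measurable (L2approx_nabla _ _).
(* The left-hand side is independent of [m], and both terms on the right tend to 0 for the sequence
   defining the closure; hence I = 0. The second term uses that the trace is a contraction. *)
have bound m : (I <= 2%:E * (hnorm2 (scval L2 (P m) - F))%:E +
    2%:E * M2norm2 (fun t => nabla_alg L2 (P m) t - G t)%R)%E.
  pose a t := f n t - tautens (nabla_alg L2 (P m) t).
  have [kRe kIm _] := L2n_tautens_nabla L2 n (P m).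
  have ma : measurable_fun (@Rplusn R n) (fun t => sqnormc (a t)).
    apply: measurable_sqnormc.
      by under eq_fun do rewrite ReD ReN; exact: measurable_funB.
    by under eq_fun do rewrite ImD ImN; exact: measurable_funB.
  have mPG := strongly_measurable_hnorm2 (strongly_measurableB (mP m) mG).
  apply: (@le_trans _ _ (2%:E * (\int[@leb R n]_(t in @Rplusn R n) (sqnormc (a t))%:E) +
    2%:E * M2norm2 (fun t => nabla_alg L2 (P m) t - G t)%R)%E); last first.
    by apply: leeD => //; apply: lee_wpmul2l; [rewrite lee_fin|exact: L2_dist_kernel].
  rewrite /M2norm2 -!ge0_integralZl_EFin//; last 4 first.
  - by move=> t _; rewrite lee_fin hnorm2_ge0.
  - exact/measurable_EFinP.
  - by move=> t _; rewrite lee_fin sqnormc_ge0.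
  - exact/measurable_EFinP.
  rewrite -ge0_integralD//; last 4 first.
  - by move=> t _; rewrite -EFinM lee_fin mulr_ge0// sqnormc_ge0.
  - by apply: measurable_funeM; exact/measurable_EFinP.
  - by move=> t _; rewrite -EFinM lee_fin mulr_ge0// hnorm2_ge0.
  - by apply: measurable_funeM; exact/measurable_EFinP.
  apply: ge0_le_integral => //.
  - by move=> t _; rewrite lee_fin sqnormc_ge0.
  - exact/measurable_EFinP.
  - by apply: emeasurable_funD; apply: measurable_funeM; exact/measurable_EFinP.
  move=> t _; rewrite -!EFinM -EFinD lee_fin.
  have -> : h t = a t + tautens (nabla_alg L2 (P m) t - G t).
    rewrite /h /a /tautens -!/(hip _ _) hipBl addrA subrK //.
  apply: le_trans (sqnormcD_le _ _) _.
  by rewrite lerD2l ler_wpM2l// sqnormc_tautens.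
have I_eq0 : I = 0%E.
  apply/eqP; rewrite eq_le I0 andbT.
  have PF0 : (hnorm2 (scval L2 (P m) - F))%:E @[m --> \oo] --> 0%E.
    apply: cvg_EFin; first exact: nearW.
    rewrite -(hnorm20 (L2 0%N)); apply: hcvg_hnorm2; rewrite /hcvg.
    by under eq_fun do rewrite subr0.
  by apply: (cvge_to_ge (cvge2D0 2 2 PF0 PG)); exact: nearW.
have : ae_eq (@leb R n) (@Rplusn R n) (fun t => (sqnormc (h t))%:E) (cst 0%E).
  apply/ae_eq_integral_abs => //; first exact/measurable_EFinP.
  by rewrite -[RHS]I_eq0; apply: eq_integral => t _; rewrite gee0_abs// lee_fin sqnormc_ge0.
apply: filterS => t ht Dt; apply/eqP; rewrite -subr_eq0; apply/eqP/sqnormc_eq0.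
by have [] := ht Dt.
Qed.

End kernel_identity.

End stroock.

Theorem theorem11 (R : realType) (Fk : fock R) (L2 : forall k, L2SC Fk k)
    (U : L2 0%N -> Fk) (HU : vacuum_unitary U)
    (F : L2 0%N) (HF : Dinf2sigma F)
    (f : forall n, n.-tuple (measurableTypeR R) -> R[i])
    (Hf : forall n, L2n (f n)) (HFf : chaos_expansion U F f) (n : nat) :
  ((exists G, is_nabla (L2 := L2) (n := n) F G) /\
   (forall G, is_nabla (L2 := L2) (n := n) F G ->
      {ae @leb R n, forall t, Rplusn t -> f n t = tautens (G t)})) /\
  ((exists G, is_D (L2 := L2) (n := n) F G) /\
   (forall G, is_D (L2 := L2) (n := n) F G ->
      {ae @leb R n, forall t, Rplusn t ->
         f n t = (n`!%:R)^-1 * tautens (G t)})).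
Proof.
have mN P : strongly_measurable (@Rplusn R n) (fun t => nabla_alg L2 P t).
  exact: L2approx_measurable (L2approx_nabla L2 n P).
have n0 : n`!%:R != 0 :> R[i] by rewrite pnatr_eq0 -lt0n fact_gt0.
split; split.
- exact: is_nabla_ex.
- by move=> G; exact: (is_nabla_kernel HU Hf HFf).
- have [G FG] := is_nabla_ex n HF.
  by exists (fun t => n`!%:R *: G t); exact: closure_ofZ FG.
move=> G FG; have mD P : strongly_measurable (@Rplusn R n) (fun t => D_alg L2 P t).
  exact: strongly_measurableZ.
(* Dividing by n! turns any representative of D^n F into one of nabla^n F, to which the first
   identity applies. *)
have : is_nabla (n := n) F (fun t => (n`!%:R)^-1 *: G t).
  have := closure_ofZ (n`!%:R)^-1 mD FG; rewrite /is_nabla; congr closure_of.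
  by apply/funext => P; apply/funext => t; rewrite scalerA mulVf// scale1r.
move=> /(is_nabla_kernel HU Hf HFf); apply: filterS => t h Dt.
have [_ _ tZ] := linear_morphs (@tautens_linear R Fk L2 n).
by rewrite h// tZ.
Qed.
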